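(* Any bounded, non-singular static charged perfect fluid that is of Majumdar-type must be dust: if a static electrogravitational field with metric $ds^2=g_{ij}dx^idx^j-e^{\omega}dt^2$ and electric potential $\phi$ satisfies the Einstein–Maxwell equations with a perfect fluid source of pressure $p$ occupying a connected bounded spatial region with non-empty boundary surface $\Sigma$, if the field is non-singular up to and including $\Sigma$ (in particular $e^{\omega}>0$ on $\Sigma$), and if $e^{\omega}=(C_0+\phi)^2$ in the fluid for some constant $C_0$, then $p=0$ throughout the fluid.
   Context: Greek indices run over $1,\dots,4$, Latin over $1,2,3$; $x^4=t$; $g_{ij}$, $\omega$, $\phi$ and all matter variables depend only on the $x^i$. The equations are $R_{\mu\nu}-\frac12Rg_{\mu\nu}=-\kappa(M_{\mu\nu}+E_{\mu\nu})$ with $\kappa>0$ and the Ricci sign convention in which $R_{44}=-\frac12e^{\omega}(\triangle\omega+\frac12|d\omega|^2)$; $\frac12\kappa E_{\mu\nu}=F_\mu{}^\alpha F_{\nu\alpha}-\frac14F_{\alpha\beta}F^{\alpha\beta}g_{\mu\nu}$ with $F_{i4}=\phi_{,i}$, $F_{ij}=0$; Maxwell's equations $\nabla_\nu F^{\mu\nu}=\frac12\kappa\sigma V^\mu$, with $V^\mu=e^{-\omega/2}\delta^\mu_4$ and $\sigma$ the proper charge density. Perfect fluid: $M^\mu{}_\nu=(p+\rho)V^\mu V_\nu+p\,\delta^\mu_\nu$. Explicitly ($\triangle$, norms and index raising being those of $g_{ij}$): $$\triangle\phi=\tfrac12\omega^{,i}\phi_{,i}+\tfrac12\kappa\sigma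 e^{\frac12\omega},\qquad -\tfrac12e^{\omega}\left(\triangle\omega+\tfrac12|d\omega|^2\right)=-\tfrac12\kappa(3p+\rho)e^{\omega}-|d\phi|^2 .$$ The conservation equation $\nabla_\mu(M^\mu{}_\nu+E^\mu{}_\nu)=0$ holds as a consequence of the equations; for $\nu=i$ it reads $p_{,i}+\frac12(p+\rho)\omega_{,i}=\sigma e^{-\frac12\omega}\phi_{,i}$. Boundary: $\Sigma$ separates the fluid from an exterior pure electric field ($M_{\mu\nu}=0$). The Synge–O'Brien junction conditions are assumed: with $\eta^i$ the unit normal to $\Sigma$, $G_{ij}\eta^i\eta^j$ is continuous across $\Sigma$ ($G_{\mu\nu}$ the Einstein tensor), and the electromagnetic field is continuous across $\Sigma$; consequently $p=0$ on $\Sigma$. *)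

(* Defs.v *)
From mathcomp Require Import all_boot all_order all_algebra.
From mathcomp Require Import all_classical all_reals all_analysis.

Set Implicit Arguments.
Unset Strict Implicit.
Unset Printing Implicit Defensive.

Import Order.TTheory GRing.Theory Num.Theory.
Import numFieldNormedType.Exports.

Local Open Scope classical_set_scope.
Local Open Scope ring_scope.

Section calculus.
Variables (R : realType) (n : nat).
Implicit Types (f : 'rV[R]_n -> R) (x : 'rV[R]_n) (U : set 'rV[R]_n).

Definition partial (i : 'I_n) f x : R := 'D_(delta_mx 0 i) f x.

Definition grad f x : 'rV[R]_n := \row_i partial i f x.

(* f is of class C^k on the open set U. *)
Fixpoint Ck (k : nat) U f : Prop :=
  if k is k'.+1 then
    forall i, (forall x, U x -> derivable f x (delta_mx 0 i)) /\
              Ck k' U (partial i f)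
  else forall x, U x -> {for x, continuous f}.

Definition Ck_matrix m1 m2 (k : nat) U (F : 'rV[R]_n -> 'M[R]_(m1, m2)) :=
  forall i j, Ck k U (fun x => F x i j).

End calculus.

(* Pseudo-Riemannian geometry in coordinates; g x is the matrix of covariant
   components g_{mu nu}, so that invmx (g x) has components g^{mu nu}. *)
Section curvature.
Variables (R : realType) (n : nat).
Implicit Types (g F T : 'rV[R]_n -> 'M[R]_n) (x : 'rV[R]_n).

Definition symmetric_posdef (M : 'M[R]_n) : Prop :=
  M^T = M /\ forall v : 'rV[R]_n, v != 0 -> 0 < (v *m M *m v^T) 0 0.

(* Gamma^a_{bc} *)
Definition christoffel g (a b c : 'I_n) x : R :=
  2^-1 * \sum_d invmx (g x) a d *
    (partial b (fun y => g y d c) x + partial c (fun y => g y d b) x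
     - partial d (fun y => g y b c) x).

(* R_{ab} = d_b Gamma^c_{ac} - d_c Gamma^c_{ab}
            + Gamma^d_{ac} Gamma^c_{db} - Gamma^d_{ab} Gamma^c_{dc}.
   This is the opposite of the convention in which round spheres have positive
   Ricci tensor; it is the one for which a static metric has
   R_{44} = - e^omega (Laplacian omega + |d omega|^2 / 2) / 2 and Einstein's
   equations read R_{ab} - R g_{ab} / 2 = - kappa T_{ab}. *)
Definition ricci g x : 'M[R]_n := \matrix_(a, b)
  (\sum_c (partial b (christoffel g c a c) x - partial c (christoffel g c a b) x)
   + \sum_c \sum_d (christoffel g d a c x * christoffel g c d b x
                    - christoffel g d a b x * christoffel g c d c x)).

Definition scalar_curvature g x : R :=
  \sum_a \sum_b invmx (g x) a b * ricci g x a b.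

Definition einstein g x : 'M[R]_n :=
  ricci g x - (2^-1 * scalar_curvature g x) *: g x.

(* F^{mu nu} = g^{mu alpha} g^{nu beta} F_{alpha beta} *)
Definition raise g F x : 'M[R]_n := invmx (g x) *m F x *m (invmx (g x))^T.

(* nabla_nu T^{mu nu} *)
Definition divergence g T (mu : 'I_n) x : R :=
  \sum_nu (partial nu (fun y => T y mu nu) x
    + \sum_b (christoffel g mu nu b x * T x b nu
              + christoffel g nu nu b x * T x mu b)).

(* The electromagnetic tensor E_{mu nu}, normalised by
   kappa E_{mu nu} / 2 =
     F_mu^alpha F_{nu alpha} - F_{alpha beta} F^{alpha beta} g_{mu nu} / 4. *)
Definition em_tensor (kappa : R) g F x : 'M[R]_n :=
  (2 / kappa) *: (F x *m invmx (g x) *m (F x)^T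
    - (4^-1 * \sum_a \sum_b F x a b * raise g F x a b) *: g x).

(* M_{mu nu}, obtained by lowering the first index of
   M^mu_nu = (p + rho) V^mu V_nu + p delta^mu_nu. *)
Definition fluid_tensor g (V : 'rV[R]_n) (p rho : R) x : 'M[R]_n :=
  g x *m ((p + rho) *: (V^T *m (V *m g x)) + p%:M).

End curvature.

(* Static fields.  Spacetime coordinates (x^1, x^2, x^3, t) form a row vector
   of size 3 + 1: Latin indices are lshift 1 i and the index 4 is rshift 3 0. *)
Section static.
Variable R : realType.
Implicit Types (g : 'rV[R]_3 -> 'M[R]_3) (omega phi : 'rV[R]_3 -> R).
Implicit Types (X : 'rV[R]_(3 + 1)).

(* ds^2 = g_{ij} dx^i dx^j - e^omega dt^2 *)
Definition static_metric g omega X : 'M[R]_(3 + 1) :=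
  block_mx (g (lsubmx X)) 0 0 (- expR (omega (lsubmx X)))%:M.

(* F_{i4} = phi_{,i} = - F_{4i} and F_{ij} = 0 *)
Definition electric_field phi X : 'M[R]_(3 + 1) :=
  block_mx 0 (grad phi (lsubmx X))^T (- grad phi (lsubmx X)) 0.

(* V^mu = e^{- omega / 2} delta^mu_4 *)
Definition velocity omega X : 'rV[R]_(3 + 1) :=
  row_mx 0 (expR (- omega (lsubmx X) / 2))%:M.

(* The Einstein-Maxwell equations at the event X, where p, rho and sigma are
   the values of the pressure, density and proper charge density at X. *)
Definition einstein_maxwell (kappa : R) g omega phi (p rho sigma : R) X : Prop :=
  let G := static_metric g omega in
  let F := electric_field phi in
  let V := velocity omega X in
  einstein G X = - kappa *: (fluid_tensor G V p rho X + em_tensor kappa G F X)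
  /\ forall mu, divergence G (raise G F) mu X = 2^-1 * kappa * sigma * V 0 mu.

(* eta^i = g^{ij} u_{,j} / |du| at x, the unit normal to the level set of u. *)
Definition unit_normal g (u : 'rV[R]_3 -> R) (x : 'rV[R]_3) : 'rV[R]_3 :=
  let du := grad u x in
  (Num.sqrt ((du *m invmx (g x) *m du^T) 0 0))^-1 *: (du *m invmx (g x)).

(* G_{ij} eta^i eta^j at the spatial point x, where G_{mu nu} is the Einstein
   tensor of the spacetime metric; it does not depend on t, taken to be 0. *)
Definition normal_einstein g omega (eta x : 'rV[R]_3) : R :=
  (eta *m ulsubmx (einstein (static_metric g omega) (row_mx x 0 : 'rV_(3 + 1)))
       *m eta^T) 0 0.

End static.

(* S is the space of points (x^i); its charts take values in R^3. *)
Section space.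
Variables (R : realType) (S : topologicalType).

Record chart := Chart {
  chart_dom : set S;
  chart_map : S -> 'rV[R]_3;
  chart_inv : 'rV[R]_3 -> S;
  chart_dom_open : open chart_dom;
  chart_img_open : open (chart_map @` chart_dom);
  chart_mapK : forall s, chart_dom s -> chart_inv (chart_map s) = s;
  chart_map_continuous : {within chart_dom, continuous chart_map};
  chart_inv_continuous :
    {within chart_map @` chart_dom, continuous chart_inv} }.

Definition transition (c c' : chart) : 'rV[R]_3 -> 'rV[R]_3 :=
  chart_map c' \o chart_inv c.

Definition smooth_manifold (A : set chart) : Prop :=
  [/\ hausdorff_space S, @second_countable S,
      forall s, exists2 c, A c & chart_dom c s &
      forall c c', A c -> A c' -> forall k,
        Ck_matrix k (chart_map c @` (chart_dom c `&` chart_dom c'))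
          (transition c c')].

(* A continuous Riemannian metric: g c x is the matrix of the components g_{ij}
   in the chart c at the point of coordinates x.  The jacobian matrix has
   entries J i j = dx'^j / dx^i. *)
Definition riemannian_metric (A : set chart)
    (g : chart -> 'rV[R]_3 -> 'M[R]_3) : Prop :=
  (forall c, A c -> forall s, chart_dom c s ->
     symmetric_posdef (g c (chart_map c s)) /\
     {for chart_map c s, continuous (g c)}) /\
  (forall c c', A c -> A c' -> forall s, chart_dom c s -> chart_dom c' s ->
     let J := jacobian (transition c c') (chart_map c s) in
     g c (chart_map c s) = J *m g c' (chart_map c' s) *m J^T).

Definition frontier (D : set S) : set S := closure D `\` D°.

Definition exterior (D : set S) : set S := ~` closure D.

(* Near the point s, in the chart c, u is a C^1 function with du <> 0 at s whose
   zero set separates D (u < 0) from its exterior (u > 0). *)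
Definition separating_function (c : chart) (D : set S) (s : S)
    (u : 'rV[R]_3 -> R) : Prop :=
  grad u (chart_map c s) != 0 /\
  exists U : set 'rV[R]_3,
    [/\ open_nbhs (chart_map c s) U, U `<=` chart_map c @` chart_dom c,
        Ck 1 U u &
        forall x, U x -> (D (chart_inv c x) <-> u x < 0) /\
                         (exterior D (chart_inv c x) <-> 0 < u x)].

Definition surface_boundary (A : set chart) (D : set S) : Prop :=
  forall s, frontier D s -> forall c, A c -> chart_dom c s ->
    exists u, separating_function c D s u.

(* f, defined on both sides of the boundary, has the same limit at s from
   both sides. *)
Definition continuous_across (D : set S) (s : S) (f : S -> R) : Prop :=
  exists l : R, f @ within (D `|` exterior D) (nbhs s) --> l.

(* Metric of class C^3 and potential of class C^2 on the open set W. *)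
Definition regular_field (A : set chart) (g : chart -> 'rV[R]_3 -> 'M[R]_3)
    (omega phi : S -> R) (W : set S) : Prop :=
  forall c, A c -> let U := chart_map c @` (chart_dom c `&` W) in
    [/\ Ck_matrix 3 U (g c), Ck 3 U (omega \o chart_inv c) &
        Ck 2 U (phi \o chart_inv c)].

Definition field_equations (A : set chart) (kappa : R)
    (g : chart -> 'rV[R]_3 -> 'M[R]_3) (omega phi p rho sigma : S -> R)
    (W : set S) : Prop :=
  forall c, A c -> forall s, chart_dom c s -> W s -> forall t : R,
    einstein_maxwell kappa (g c) (omega \o chart_inv c) (phi \o chart_inv c)
      (p s) (rho s) (sigma s) (row_mx (chart_map c s) t%:M).

(* Synge-O'Brien: G_{ij} eta^i eta^j is continuous across the boundary, eta
   being the unit normal at the boundary point considered. *)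
Definition einstein_junction (A : set chart)
    (g : chart -> 'rV[R]_3 -> 'M[R]_3) (omega : S -> R) (D : set S) : Prop :=
  forall s, frontier D s -> forall c, A c -> chart_dom c s ->
  forall u, separating_function c D s u ->
    continuous_across D s (fun q =>
      normal_einstein (g c) (omega \o chart_inv c)
        (unit_normal (g c) u (chart_map c s)) (chart_map c q)).

(* The field F_{i4} = phi_{,i} is continuous across the boundary. *)
Definition electric_junction (A : set chart) (phi : S -> R) (D : set S) : Prop :=
  forall s, frontier D s -> forall c, A c -> chart_dom c s -> forall i : 'I_3,
    continuous_across D s (fun q =>
      partial i (phi \o chart_inv c) (chart_map c q)).

End space.

(* Main.v *)
(* In the fluid put psi = C0 + phi, so that e^omega = psi^2.  The tt component of
   Einstein's equations together with Maxwell's equation gives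
   psi sigma e^(- omega / 2) = 3 p + rho, and the conservation law
   p_i + (p + rho) omega_i / 2 = sigma e^(- omega / 2) phi_i then becomes
   psi p_i = 2 p psi_i: the function p e^(- omega) is locally constant, hence
   constant on the connected region D.  At a boundary point the continuity of
   G_ij eta^i eta^j and of d phi forces p to tend to 0, so the constant vanishes.

   The conservation law is the contracted Bianchi identity.  It is proved in
   coordinates, for a C^3 metric: the matrices Gamma_a of the connection satisfy
   the second Bianchi identity, and the raised curvature R_bc g^-1 is
   antisymmetric because the second derivatives of g^-1 commute.  The pressure,
   on which no regularity is assumed, is differentiable because it is read off
   from the Einstein tensor. *)

From HB Require Import structures.
Require Import Defs.
From mathcomp Require Import all_boot all_order all_algebra.
From mathcomp Require Import all_classical all_reals all_analysis.
From mathcomp Require Import ring lra.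

Set Implicit Arguments.
Unset Strict Implicit.
Unset Printing Implicit Defensive.

Import Order.TTheory GRing.Theory Num.Theory.
Import numFieldNormedType.Exports.

Local Open Scope classical_set_scope.
Local Open Scope ring_scope.

(** The Laplacian is never formed. With w^k = e^(-omega) phi^{,k}, which is the component F^{4k} of
    the field, both Maxwell's equation and R_44 contain the same divergence d_k w^k + w^k d_k log
    sqrt |det G|; eliminating it between them is all that the charge relation needs. The combination
    3 p + rho comes from trace reversal: the electromagnetic tensor is traceless, so R = kappa (3 p
    - rho). Since e^(-omega / 2) = 1 / |psi| and the sign of psi is not fixed, the charge is carried
    only in the product psi sigma e^(-omega / 2). At the boundary no derivative of the metric is
    known to have a limit, so everything rests on the single number G(eta, eta). On either side the
    field equations write it as - kappa p g(eta, eta) plus an electromagnetic part built from g,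
    omega and d phi alone; that part has the same limit from both sides, and outside p = 0. Hence p
    tends to 0 from inside. But p = lam e^omega in the fluid, and e^omega is positive at the
    boundary point, so lam = 0. A boundary where e^omega vanished would leave lam undetermined. *)

Lemma dist_halves (R : realType) (p q z e : R) :
  `|p - z| <= e / 2 -> `|q - z| <= e / 2 -> `|p - q| <= e.
Proof.
move=> e1; rewrite distrC => e2.
by rewrite (le_trans (ler_distD z _ _)) // [leRHS]splitr lerD.
Qed.

(** * Partial derivatives and functions of class C^k *)

Lemma continuous_distP (R : realType) (T : topologicalType) (f : T -> R) (x : T) :
  {for x, continuous f} <->
  forall e : R, 0 < e -> \forall y \near x, `|f x - f y| <= e.
Proof. by split=> [/cvgrPdist_le|h]; last apply/cvgrPdist_le. Qed.

Section mean_value.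
Variables (R : realType) (n : nat).
Implicit Types (f : 'rV[R]_n -> R) (x v : 'rV[R]_n) (U : set 'rV[R]_n).

Lemma is_derive_along f x v s : derivable f (s *: v + x) v ->
  is_derive s 1 (fun h : R => f (h *: v + x)) ('D_v f (s *: v + x)).
Proof.
move=> df.
have E : (fun h : R => h^-1 *: (((fun h0 : R => f (h0 *: v + x)) \o shift s) (h *: (1:R))
    - f (s *: v + x))) =
  (fun h : R => h^-1 *: ((f \o shift (s *: v + x)) (h *: v) - f (s *: v + x))).
  by apply/funext => h /=; rewrite [h *: 1]mulr1 scalerDl addrA.
split; first by rewrite /derivable E.
by rewrite /derive E.
Qed.

(** The mean value theorem on a line. Bounding the parameter by [|t|] instead of using an interval
    covers both signs of [t]. *)
Lemma mean_value_along f x v t :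
  (forall s, `|s| <= `|t| -> derivable f (s *: v + x) v) ->
  exists2 s, `|s| <= `|t| & f (t *: v + x) - f x = t * 'D_v f (s *: v + x).
Proof.
move=> df.
have itvP s a b : `|a| <= `|t| -> `|b| <= `|t| -> s \in `[a, b]%R -> `|s| <= `|t|.
  move=> /ler_normlP[a1 a2] /ler_normlP[b1 b2]; rewrite in_itv/= => /andP[h1 h2].
  by apply/ler_normlP; split; lra.
have key a b : a <= b -> `|a| <= `|t| -> `|b| <= `|t| ->
    exists2 s, `|s| <= `|t| & f (b *: v + x) - f (a *: v + x) =
      'D_v f (s *: v + x) * (b - a).
  move=> ab ha hb.
  have := @MVT_segment R (fun h => f (h *: v + x))
    (fun s => 'D_v f (s *: v + x)) a b ab.
  case.
  - move=> s /subset_itv_oo_cc sab; apply: is_derive_along.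
    by apply: df; exact: itvP ha hb sab.
  - apply: derivable_within_continuous => s sab.
    have /df/is_derive_along[] // := itvP _ _ _ ha hb sab.
  - by move=> s sab E; exists s => //; exact: itvP ha hb sab.
have [t0|t0] := leP 0 t.
  have [||s hs E] := key 0 t t0; rewrite ?normr0 //.
  by exists s => //; move: E; rewrite scale0r add0r subr0 mulrC.
have [||s hs E] := key t 0 (ltW t0); rewrite ?normr0 //.
exists s => //; move: E; rewrite scale0r add0r sub0r => E.
by rewrite -opprB E; lra.
Qed.

Let stair (x y : 'rV[R]_n) (k : nat) : 'rV[R]_n :=
  \row_j (if (j < k)%N then y 0 j else x 0 j).

(* Change the coordinates of x into those of y one at a time. *)
Lemma partial_lipschitz f x r M :
  (forall z, ball x r z -> forall i, derivable f z (delta_mx 0 i)) ->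
  (forall z, ball x r z -> forall i, `|partial i f z| <= M) ->
  forall y, ball x r y -> `|f y - f x| <= M * \sum_i `|y 0 i - x 0 i|.
Proof.
move=> df hM y bxy.
have r0 : 0 < r by case: bxy.
have bxyi j : `|y 0 j - x 0 j| < r by rewrite distrC; exact: bxy.2.
suff H k : (k <= n)%N -> `|f (stair x y k) - f x| <=
    M * \sum_(i < n | (i < k)%N) `|y 0 i - x 0 i|.
  have := H n (leqnn n); rewrite (eq_bigl xpredT) => [|i]; last by rewrite ltn_ord.
  by have -> : stair x y n = y by apply/rowP => j; rewrite mxE ltn_ord.
elim: k => [_|k IH kn].
  rewrite big_pred0; last by move=> i; rewrite ltn0.
  rewrite (_ : stair x y 0 = x) ?subrr ?normr0 ?mulr0 //.
  by apply/rowP => j; rewrite mxE.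
pose i : 'I_n := Ordinal kn.
have stairS : stair x y k.+1 = (y 0 i - x 0 i) *: delta_mx 0 i + stair x y k.
  apply/rowP => j; rewrite !mxE eqxx /=.
  case: (eqVneq j i) => [->|ji] /=; first by rewrite ltnSn ltnn; lra.
  rewrite mulr0 add0r ltnS leq_eqVlt.
  have /negPf-> // : (j != k :> nat) by [].
have bs s : `|s| <= `|y 0 i - x 0 i| -> ball x r (s *: delta_mx 0 i + stair x y k).
  move=> hs; split => // a j; rewrite (ord1 a) /ball /= distrC !mxE eqxx /=.
  case: (eqVneq j i) => [->|ji] /=.
    by rewrite ltnn mulr1 addrK (le_lt_trans hs).
  rewrite mulr0 add0r; case: ifP => _ //.
  by rewrite subrr normr0.
have [s hs E] := @mean_value_along f (stair x y k) (delta_mx 0 i) (y 0 i - x 0 i)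
   (fun s hs => df _ (bs s hs) i).
have -> : f (stair x y k.+1) - f x =
  (f (stair x y k.+1) - f (stair x y k)) + (f (stair x y k) - f x) by ring.
rewrite (bigD1 i) ?ltnSn //= mulrDr (le_trans (ler_normD _ _)) // lerD //.
  rewrite stairS E normrM mulrC ler_wpM2r //.
  exact: (hM _ (bs _ hs) i).
rewrite (eq_bigl (fun j : 'I_n => (j < k)%N)) ?IH 1?ltnW // => j.
rewrite ltnS [RHS]ltn_neqAle andbC; congr (_ && _).
Qed.

(** For k > 0, [Ck] asks only for partial derivatives, not for continuity of the function itself.
    Continuity is recovered because continuous partials are bounded near each point, which makes the
    function locally Lipschitz. *)
Lemma Ck1_continuous U f : open U -> Ck 1 U f -> Ck 0 U f.
Proof.
move=> oU df x Ux.
have Mi i : \forall z \near x, `|partial i f z| <= `|partial i f x| + 1.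
  have /(_ x Ux) := (df i).2.
  move=> /continuous_distP /(_ 1 ltr01); apply: filterS => z /= hz.
  have -> : partial i f z = partial i f x - (partial i f x - partial i f z) by ring.
  by rewrite (le_trans (ler_normB _ _)) // lerD2l.
have Mx := filter_forall (nbhs_filter x) Mi.
have Ux' : \forall z \near x, U z by exact: open_nbhs_nbhs.
have [r /= r0 hr] := (nbhs_ballP _ _).1 (filterI Mx Ux').
pose M : R := \sum_i (`|partial i f x| + 1).
have M0 : 0 <= M by apply: sumr_ge0 => i _; rewrite addr_ge0.
have lip := @partial_lipschitz f x r M (fun z bz i => (df i).1 z (hr z bz).2).
apply/continuous_distP => e e0.
(* The summand 1 keeps the denominator positive even when [M] or [n] is 0. *)
have : \forall y \near x, ball x (Num.min r (e / (M * n%:R + 1))) y.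
  apply: nbhsx_ballx; rewrite lt_min r0 divr_gt0 //.
  by rewrite ltr_wpDl // mulr_ge0.
apply: filterS => y /= [d0 hy].
have byr : ball x r y.
  split=> // a j; have := hy a j; rewrite /ball /= lt_min => /andP[]//.
rewrite distrC (le_trans (lip _ y byr)) //.
  move=> z bz i; rewrite (le_trans ((hr z bz).1 i)) //.
  by rewrite /M (bigD1 i) //= lerDl sumr_ge0 // => j _; rewrite addr_ge0.
have h2 : \sum_i `|y 0 i - x 0 i| <= n%:R * (e / (M * n%:R + 1)).
  rewrite (le_trans (ler_sum _ (G := fun=> e / (M * n%:R + 1)) _)) //.
    move=> i _; have := hy 0 i; rewrite /ball /= lt_min distrC => /andP[_ /ltW]//.
  by rewrite sumr_const card_ord mulr_natl.
rewrite (le_trans (ler_wpM2l M0 h2)) //.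
have Mn : 0 < M * n%:R + 1 by rewrite ltr_wpDl // mulr_ge0.
rewrite !mulrA ler_pdivrMr // [leRHS]mulrC mulrDl mul1r lerDl; exact: ltW.
Qed.

Lemma CkS k U f : open U -> Ck k.+1 U f -> Ck k U f.
Proof.
move=> oU; elim: k f => [|k IH] f; first exact: Ck1_continuous.
by move=> df i; have [d1 d2] := df i; split=> //; exact: IH.
Qed.

Lemma Ck_le k l U f : open U -> (k <= l)%N -> Ck l U f -> Ck k U f.
Proof.
move=> oU /subnK<-; elim: (l - k)%N => [//|m IH] /= h.
by apply: IH; exact: CkS.
Qed.

Lemma Ck_sub k U U' f : U' `<=` U -> Ck k U f -> Ck k U' f.
Proof.
move=> s; elim: k f => [|k IH] f /=; first by move=> h x /s; exact: h.
by move=> h i; have [d c] := h i; split; [move=> x /s; exact: d|exact: IH].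
Qed.

(** The Lipschitz estimate with constant 0. *)
Lemma locally_constant_of_partial0 f x r :
  (forall z, ball x r z -> forall i, derivable f z (delta_mx 0 i)) ->
  (forall z, ball x r z -> forall i, partial i f z = 0) ->
  forall y, ball x r y -> f y = f x.
Proof.
move=> df d0 y bxy; apply/eqP; rewrite -subr_eq0 -normr_le0.
have := @partial_lipschitz f x r 0 df _ y bxy; rewrite mul0r; apply.
by move=> z bz i; rewrite d0 ?normr0.
Qed.

(** Two applications of the mean value theorem: to y |-> f (h b + y) - f y in the direction [a],
    then to the derivative of f along [a] in the direction [b]. *)
Lemma second_difference f x (a b : 'rV[R]_n) h :
    (forall s t, `|s| <= `|h| -> `|t| <= `|h| -> derivable f (t *: b + (s *: a + x)) a) ->
    (forall s t, `|s| <= `|h| -> `|t| <= `|h| -> derivable ('D_a f) (t *: b + (s *: a + x)) b) ->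
    exists s t, [/\ `|s| <= `|h|, `|t| <= `|h| &
      f (h *: b + (h *: a + x)) - f (h *: a + x) - f (h *: b + x) + f x =
      h * (h * 'D_b ('D_a f) (t *: b + (s *: a + x)))].
Proof.
move=> d1 d2.
pose G y := f (h *: b + y) - f y.
have dG s : `|s| <= `|h| -> is_derive (s *: a + x) a G
    ('D_a f (h *: b + (s *: a + x)) - 'D_a f (s *: a + x)).
  move=> hs; apply: is_deriveB.
    have dd := d1 s h hs (lexx _).
    have E y : (fun k : R => k^-1 *: (((fun z => f (h *: b + z)) \o shift y) (k *: a)
       - f (h *: b + y))) = (fun k : R => k^-1 *: ((f \o shift (h *: b + y)) (k *: a) - f (h *: b + y))).
      by apply/funext => k /=; rewrite addrCA.
    by split; rewrite /derivable /derive E.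
  apply: derivableP; have := d1 s 0 hs; rewrite normr0 scale0r add0r; exact.
have [s hs E1] := @mean_value_along G x a h (fun s hs => @ex_derive _ _ _ _ _ _ _ (dG s hs)).
have [t ht E2] := @mean_value_along ('D_a f) (s *: a + x) b h (fun t => d2 s t hs).
exists s, t; split => //; rewrite -E2.
move: E1; rewrite (@derive_val _ _ _ _ _ _ _ (dG s hs)) => <-.
by rewrite /G; ring.
Qed.

(* The second difference of f is computed by the mean value theorem in either
   order of the two variables. *)
Lemma schwarz U f i j x : open U -> Ck 2 U f -> U x ->
  partial i (partial j f) x = partial j (partial i f) x.
Proof.
move=> oU df Ux.
pose a : 'rV[R]_n := delta_mx 0 i; pose b : 'rV[R]_n := delta_mx 0 j.
apply/eqP; rewrite -subr_eq0 -normr_le0; apply/ler_addgt0Pr => e e0; rewrite add0r.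
have cc k l : \forall z \near x, `|partial k (partial l f) x - partial k (partial l f) z| <= e / 2.
  have /(_ x Ux) := ((df l).2 k).2.
  by move=> /continuous_distP; apply; rewrite divr_gt0.
have [r /= r0 hr] := (nbhs_ballP _ _).1
  (filterI (filterI (cc i j) (cc j i)) (open_nbhs_nbhs (conj oU Ux))).
(* Two steps of length at most r / 3 stay inside the ball of radius r, even along the same axis. *)
pose h := r / 3.
have bs k l s t : `|s| <= `|h| -> `|t| <= `|h| ->
   ball x r (t *: delta_mx 0 k + (s *: delta_mx 0 l + x)).
  have h0 : 0 < h by rewrite divr_gt0.
  rewrite (gtr0_norm h0) => hs ht; split => // u m; rewrite (ord1 u) /ball /= distrC !mxE eqxx /=.
  rewrite addrA addrK (le_lt_trans (ler_normD _ _)) //.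
  have bb c (q : bool) : `|c| <= h -> `|c * q%:R| <= h.
    by case: q; rewrite ?mulr1 ?mulr0 ?normr0 // => _; exact: ltW.
  rewrite (le_lt_trans (lerD (bb _ _ ht) (bb _ _ hs))) // /h; lra.
have hn0 : h != 0 by rewrite gt_eqF // divr_gt0.
have [||s [t [hs ht E1]]] := @second_difference f x a b h.
- by move=> s t hs ht; apply: (df i).1; apply: (hr _ (bs _ _ _ _ hs ht)).2.
- by move=> s t hs ht; apply: ((df i).2 j).1; apply: (hr _ (bs _ _ _ _ hs ht)).2.
have [||s' [t' [hs' ht' E2]]] := @second_difference f x b a h.
- by move=> s' t' hs' ht'; apply: (df j).1; apply: (hr _ (bs _ _ _ _ hs' ht')).2.
- by move=> s' t' hs' ht'; apply: ((df j).2 i).1; apply: (hr _ (bs _ _ _ _ hs' ht')).2.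
have E : 'D_b ('D_a f) (t *: b + (s *: a + x)) = 'D_a ('D_b f) (t' *: a + (s' *: b + x)).
  move: E1 E2; rewrite (addrCA (h *: a)).
  set X := 'D_b _ _; set Y := 'D_a _ _; move: X Y => X Y E1 E2.
  have : h * (h * X) = h * (h * Y) by rewrite -E1 -E2; ring.
  by move=> /(mulfI hn0) /(mulfI hn0).
(* The two mixed derivatives agree at two possibly different points of the ball; each is within e /
   2 of its value at x. *)
have [[_ e1] _] := hr _ (bs j i s t hs ht).
have [[e2 _] _] := hr _ (bs i j s' t' hs' ht').
rewrite /partial in e1 e2 *; rewrite -/a -/b in e1 e2 *.
by rewrite E in e1; exact: dist_halves e2 e1.
Qed.

End mean_value.

(** * Rules of differentiation and closure properties of the classes C^k *)

Section Ck_algebra.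
Variables (R : realType) (n : nat).
Implicit Types (f g : 'rV[R]_n -> R) (x v : 'rV[R]_n) (U : set 'rV[R]_n).

(** Along the line h |-> h v + x this is the one-variable chain rule at h = 0. *)
Lemma is_derive_expR_comp f x v : derivable f x v ->
  is_derive x v (fun y => expR (f y)) (expR (f x) * 'D_v f x).
Proof.
move=> df.
have E (F : 'rV[R]_n -> R) : (fun h : R => h^-1 *: (((fun h : R => F (h *: v + x)) \o shift 0) (h *: (1:R))
    - F (0 *: v + x))) = (fun h : R => h^-1 *: ((F \o shift x) (h *: v) - F x)).
  by apply/funext => h /=; rewrite [h *: 1]mulr1 addr0 scale0r add0r.
have d0 : is_derive (0:R) 1 (fun h : R => f (h *: v + x)) ('D_v f x).
  by split; rewrite /derivable /derive E.
have d1 := is_derive_expR (f (0 *: v + x)).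
have := @is_derive1_comp _ expR (fun h : R => f (h *: v + x)) 0 _ _ d1 d0.
rewrite scale0r add0r => -[]; rewrite /derivable /derive => h1 h2.
have E2 := E (fun y => expR (f y)); rewrite /comp in h1 h2.
by split; rewrite /derivable /derive -E2.
Qed.

Lemma partialD i f g x : derivable f x (delta_mx 0 i) ->
  derivable g x (delta_mx 0 i) ->
  partial i (fun y => f y + g y) x = partial i f x + partial i g x.
Proof. exact: deriveD. Qed.

Lemma partialN i f x : derivable f x (delta_mx 0 i) ->
  partial i (fun y => - f y) x = - partial i f x.
Proof. exact: deriveN. Qed.

Lemma partialB i f g x : derivable f x (delta_mx 0 i) ->
  derivable g x (delta_mx 0 i) ->
  partial i (fun y => f y - g y) x = partial i f x - partial i g x.
Proof. exact: deriveB. Qed.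

Lemma partialM i f g x : derivable f x (delta_mx 0 i) ->
  derivable g x (delta_mx 0 i) ->
  partial i (fun y => f y * g y) x = partial i f x * g x + f x * partial i g x.
Proof.
move=> df dg; transitivity (f x * partial i g x + g x * partial i f x).
  exact: (deriveM df dg).
by rewrite [LHS]addrC; congr (_ + _); exact: mulrC.
Qed.

Lemma partialZ i (c : R) f x : derivable f x (delta_mx 0 i) ->
  partial i (fun y => c * f y) x = c * partial i f x.
Proof. exact: deriveZ. Qed.

Lemma partialV i f x : f x != 0 -> derivable f x (delta_mx 0 i) ->
  partial i (fun y => (f y)^-1) x = - ((f x)^-1 * (f x)^-1 * partial i f x).
Proof.
move=> f0 df; rewrite /partial deriveV // scaleNr; congr (- (_ * _)).
by rewrite expr2 invfM.
Qed.

Lemma partial_cst i (c : R) x : partial i (fun=> c) x = 0.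
Proof. exact: derive_cst. Qed.

Lemma partial_sum (I : Type) (r : seq I) (P : pred I) i (F : I -> 'rV[R]_n -> R) x :
  (forall k, P k -> derivable (F k) x (delta_mx 0 i)) ->
  derivable (fun y => \sum_(k <- r | P k) F k y) x (delta_mx 0 i) /\
  partial i (fun y => \sum_(k <- r | P k) F k y) x = \sum_(k <- r | P k) partial i (F k) x.
Proof.
move=> dF; elim: r => [|a r [IH1 IH2]].
  have E : (fun y => \sum_(k <- [::] | P k) F k y) = (fun=> 0 : R).
    by apply/funext => y; rewrite big_nil.
  by rewrite E partial_cst big_nil; split => //; exact: derivable_cst.
have E : (fun y => \sum_(k <- a :: r | P k) F k y) =
  (fun y => (if P a then F a y else 0) + \sum_(k <- r | P k) F k y).
  by apply/funext => y; rewrite big_cons; case: ifP; rewrite ?add0r.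
rewrite E big_cons; case: (boolP (P a)) => Pa.
  have da := dF a Pa.
  split; first exact: derivableD da IH1.
  by rewrite -IH2; exact: (partialD da IH1).
have -> : (fun y => 0 + \sum_(k <- r | P k) F k y) = (fun y => \sum_(k <- r | P k) F k y).
  by apply/funext => y; rewrite add0r.
by [].
Qed.

Lemma near_open (T : topologicalType) (U : set T) (P : T -> Prop) (x : T) :
  open U -> U x -> (forall y, U y -> P y) -> \forall y \near x, P y.
Proof. by move=> oU Ux UP; apply: filterS UP _; exact: open_nbhs_nbhs. Qed.

Lemma eq_partial U i f g x : open U -> (forall y, U y -> f y = g y) -> U x ->
  partial i f x = partial i g x.
Proof. by move=> oU fg Ux; apply: near_eq_derive; exact: near_open fg. Qed.

Lemma eq_derivable U v f g x : open U -> (forall y, U y -> f y = g y) -> U x ->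
  derivable f x v -> derivable g x v.
Proof. by move=> oU fg Ux; apply: near_eq_derivable; exact: near_open fg. Qed.

Lemma eq_Ck U k f g : open U -> (forall y, U y -> f y = g y) ->
  Ck k U f -> Ck k U g.
Proof.
move=> oU; elim: k f g => [|k IH] f g fg /= cf.
  move=> x Ux; have := cf x Ux.
  rewrite /prop_for /continuous_at -fg //.
  have H : \forall y \near x, f y = g y by exact: (near_open oU Ux fg).
  by apply: cvg_trans; exact: near_eq_cvg H.
move=> i; have [d c] := cf i; split.
  by move=> x Ux; apply: (eq_derivable oU fg Ux); exact: d.
apply: IH c => y Uy; exact: (eq_partial _ oU fg).
Qed.

Lemma Ck_cst U k (c : R) : open U -> Ck k U (fun=> c).
Proof.
move=> oU; elim: k c => [|k IH] c /=; first by move=> x _; exact: cst_continuous.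
move=> i; split; first by move=> x _; exact: derivable_cst.
by apply: eq_Ck (IH 0) => // y _; rewrite partial_cst.
Qed.

Lemma Ck_add U k f g : open U -> Ck k U f -> Ck k U g ->
  Ck k U (fun x => f x + g x).
Proof.
move=> oU; elim: k f g => [|k IH] f g cf cg /=.
  by move=> x Ux; exact: (cvgD (cf x Ux) (cg x Ux)).
move=> i; have [df cf'] := cf i; have [dg cg'] := cg i; split.
  by move=> x Ux; exact: (derivableD (df x Ux) (dg x Ux)).
apply: eq_Ck (IH _ _ cf' cg') => // y Uy.
by rewrite (partialD (df y Uy) (dg y Uy)).
Qed.

Lemma Ck_mul U k f g : open U -> Ck k U f -> Ck k U g ->
  Ck k U (fun x => f x * g x).
Proof.
move=> oU; elim: k f g => [|k IH] f g cf cg /=.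
  by move=> x Ux; exact: (cvgM (cf x Ux) (cg x Ux)).
move=> i; have [df cf'] := cf i; have [dg cg'] := cg i; split.
  by move=> x Ux; exact: (derivableM (df x Ux) (dg x Ux)).
apply: (@eq_Ck _ _ (fun y => partial i f y * g y + f y * partial i g y)) => //.
  by move=> y Uy; rewrite (partialM (df y Uy) (dg y Uy)).
by apply: Ck_add => //; apply: IH => //; exact: CkS.
Qed.

Lemma Ck_scale U k (c : R) f : open U -> Ck k U f -> Ck k U (fun x => c * f x).
Proof. by move=> oU; apply: Ck_mul => //; exact: Ck_cst. Qed.

Lemma Ck_opp U k f : open U -> Ck k U f -> Ck k U (fun x => - f x).
Proof.
move=> oU cf; apply: eq_Ck (Ck_scale (-1) oU cf) => // y _; by rewrite mulN1r.
Qed.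

Lemma Ck_inv U k f : open U -> (forall x, U x -> f x != 0) -> Ck k U f ->
  Ck k U (fun x => (f x)^-1).
Proof.
move=> oU f0; elim: k => [|k IH] cf /=.
  by move=> x Ux; exact: (cvgV (f0 x Ux) (cf x Ux)).
move=> i; have [df cf'] := cf i; split.
  by move=> x Ux; exact: (derivableV (f0 x Ux) (df x Ux)).
apply: (@eq_Ck _ _ (fun y => - ((f y)^-1 * (f y)^-1 * partial i f y))) => //.
  by move=> y Uy; rewrite (partialV (f0 y Uy) (df y Uy)).
have IHf := IH (CkS oU cf).
by apply: Ck_opp => //; apply: Ck_mul => //; apply: Ck_mul.
Qed.

Lemma Ck_expR U k f : open U -> Ck k U f -> Ck k U (fun x => expR (f x)).
Proof.
move=> oU; elim: k => [|k IH] cf /=.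
  move=> x Ux; exact: (continuous_comp (cf x Ux) (@continuous_expR R (f x))).
move=> i; have [df cf'] := cf i; split.
  by move=> x Ux; have [] := is_derive_expR_comp (df x Ux).
apply: (@eq_Ck _ _ (fun y => expR (f y) * partial i f y)) => //.
  by move=> y Uy; have [_ <-] := is_derive_expR_comp (df y Uy).
by apply: Ck_mul => //; apply: IH; exact: CkS.
Qed.

Lemma Ck_sum U k (I : Type) (r : seq I) (P : pred I) (F : I -> 'rV[R]_n -> R) :
  open U -> (forall j, P j -> Ck k U (F j)) ->
  Ck k U (fun y => \sum_(j <- r | P j) F j y).
Proof.
move=> oU cF; elim: r => [|a r IH].
  by apply: eq_Ck (Ck_cst k 0 oU) => // y _; rewrite big_nil.
case: (boolP (P a)) => Pa.
  by apply: eq_Ck (Ck_add oU (cF a Pa) IH) => // y _; rewrite big_cons Pa.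
by apply: eq_Ck IH => // y _; rewrite big_cons (negPf Pa).
Qed.

Lemma Ck_prod U k (I : Type) (r : seq I) (P : pred I) (F : I -> 'rV[R]_n -> R) :
  open U -> (forall j, P j -> Ck k U (F j)) ->
  Ck k U (fun y => \prod_(j <- r | P j) F j y).
Proof.
move=> oU cF; elim: r => [|a r IH].
  by apply: eq_Ck (Ck_cst k 1 oU) => // y _; rewrite big_nil.
case: (boolP (P a)) => Pa.
  by apply: eq_Ck (Ck_mul oU (cF a Pa) IH) => // y _; rewrite big_cons Pa.
by apply: eq_Ck IH => // y _; rewrite big_cons (negPf Pa).
Qed.

Lemma Ck_det U k m (F : 'rV[R]_n -> 'M[R]_m) : open U ->
  Ck_matrix k U F -> Ck k U (fun x => \det (F x)).
Proof.
move=> oU cF; rewrite /determinant; apply: Ck_sum => // s _.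
by apply: Ck_scale => //; apply: Ck_prod => // i _.
Qed.

(** Cramer's rule: the entries of the inverse are cofactors, polynomial in the entries of [F],
    divided by a determinant that does not vanish on [U]. *)
Lemma Ck_invmx U k m (F : 'rV[R]_n -> 'M[R]_m) : open U ->
  (forall x, U x -> F x \in unitmx) ->
  Ck_matrix k U F -> Ck_matrix k U (fun x => invmx (F x)).
Proof.
move=> oU uF cF i j.
apply: (@eq_Ck _ _ (fun x => (\det (F x))^-1 * ((-1) ^+ (j + i) *
    \det (row' j (col' i (F x)))))) => //.
  by move=> x Ux; rewrite /invmx uF // !mxE.
apply: Ck_mul => //.
  apply: Ck_inv => //; last exact: Ck_det.
  by move=> x /uF; rewrite unitmxE unitfE.
apply: Ck_scale => //; apply: Ck_det => // a b.
by apply: eq_Ck (cF _ _) => // x _; rewrite !mxE.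
Qed.

Lemma Ck_mulmx U k m p q (F : 'rV[R]_n -> 'M[R]_(m, p)) (G : 'rV[R]_n -> 'M[R]_(p, q)) :
  open U -> Ck_matrix k U F -> Ck_matrix k U G ->
  Ck_matrix k U (fun x => F x *m G x).
Proof.
move=> oU cF cG i j; apply: (@eq_Ck _ _ (fun x => \sum_l F x i l * G x l j)) => //.
  by move=> x Ux; rewrite mxE.
by apply: Ck_sum => // l _; exact: Ck_mul.
Qed.

Lemma Ck_partial U k i f : Ck k.+1 U f -> Ck k U (partial i f).
Proof. by move=> /(_ i)[]. Qed.

End Ck_algebra.

(** * The contracted Bianchi identity *)

(* Locked: unification would otherwise unfold derivatives into limits. *)
HB.lock Definition dmx (R : realType) (n m p : nat) (i : 'I_n)
    (F : 'rV[R]_n -> 'M[R]_(m, p)) (x : 'rV[R]_n) : 'M[R]_(m, p) :=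
  \matrix_(a, b) partial i (fun y => F y a b) x.

Section matrix_derivative.
Variables (R : realType) (n : nat).
Implicit Types (x : 'rV[R]_n) (U : set 'rV[R]_n).

Definition derivable_mx m p (i : 'I_n) (F : 'rV[R]_n -> 'M[R]_(m, p)) x :=
  forall a b, derivable (fun y => F y a b) x (delta_mx 0 i).

Lemma dmxE m p i (F : 'rV[R]_n -> 'M[R]_(m, p)) x a b :
  dmx i F x a b = partial i (fun y => F y a b) x.
Proof. by rewrite dmx.unlock mxE. Qed.

Lemma eq_dmx m p U i (F G : 'rV[R]_n -> 'M[R]_(m, p)) x : open U ->
  (forall y, U y -> F y = G y) -> U x -> dmx i F x = dmx i G x.
Proof.
move=> oU FG Ux; apply/matrixP => a b; rewrite !dmxE.
by apply: (eq_partial _ oU _ Ux) => y Uy; rewrite FG.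
Qed.

Lemma derivable_mxB m p i (F G : 'rV[R]_n -> 'M[R]_(m, p)) x :
  derivable_mx i F x -> derivable_mx i G x ->
  derivable_mx i (fun y => F y - G y) x.
Proof.
move=> dF dG a b.
have -> : (fun y => (F y - G y) a b) = (fun y => F y a b - G y a b).
  by apply/funext => y; rewrite !mxE.
exact: (derivableB (dF a b) (dG a b)).
Qed.

Lemma dmxB m p i (F G : 'rV[R]_n -> 'M[R]_(m, p)) x :
  derivable_mx i F x -> derivable_mx i G x ->
  dmx i (fun y => F y - G y) x = dmx i F x - dmx i G x.
Proof.
move=> dF dG; apply/matrixP => a b; rewrite dmxE.
have -> : (fun y => (F y - G y) a b) = (fun y => F y a b - G y a b).
  by apply/funext => y; rewrite !mxE.
by rewrite (partialB (dF a b) (dG a b)) [RHS]mxE [X in _ = _ + X]mxE !dmxE.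
Qed.

Lemma dmxN m p i (F : 'rV[R]_n -> 'M[R]_(m, p)) x :
  derivable_mx i F x -> dmx i (fun y => - F y) x = - dmx i F x.
Proof.
move=> dF; apply/matrixP => a b; rewrite dmxE.
have -> : (fun y => (- F y) a b) = (fun y => - F y a b).
  by apply/funext => y; rewrite !mxE.
by rewrite (partialN (dF a b)) [RHS]mxE dmxE.
Qed.

Lemma dmxD m p i (F G : 'rV[R]_n -> 'M[R]_(m, p)) x :
  derivable_mx i F x -> derivable_mx i G x ->
  dmx i (fun y => F y + G y) x = dmx i F x + dmx i G x.
Proof.
move=> dF dG; apply/matrixP => a b; rewrite dmxE.
have -> : (fun y => (F y + G y) a b) = (fun y => F y a b + G y a b).
  by apply/funext => y; rewrite !mxE.
by rewrite (partialD (dF a b) (dG a b)) [RHS]mxE !dmxE.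
Qed.

Lemma derivable_mxM m p q i (F : 'rV[R]_n -> 'M[R]_(m, p))
    (G : 'rV[R]_n -> 'M[R]_(p, q)) x :
  derivable_mx i F x -> derivable_mx i G x ->
  derivable_mx i (fun y => F y *m G y) x.
Proof.
move=> dF dG a b.
have -> : (fun y => (F y *m G y) a b) = (fun y => \sum_k F y a k * G y k b).
  by apply/funext => y; rewrite !mxE.
exact: (partial_sum _ (fun k _ => derivableM (dF a k) (dG k b))).1.
Qed.

Lemma dmxM m p q i (F : 'rV[R]_n -> 'M[R]_(m, p))
    (G : 'rV[R]_n -> 'M[R]_(p, q)) x :
  derivable_mx i F x -> derivable_mx i G x ->
  dmx i (fun y => F y *m G y) x = dmx i F x *m G x + F x *m dmx i G x.
Proof.
move=> dF dG; apply/matrixP => a b; rewrite dmxE.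
have -> : (fun y => (F y *m G y) a b) = (fun y => \sum_k F y a k * G y k b).
  by apply/funext => y; rewrite !mxE.
rewrite (partial_sum _ (fun k _ => derivableM (dF a k) (dG k b))).2.
rewrite [RHS]mxE [X in _ = X + _]mxE [X in _ = _ + X]mxE -big_split /=.
by apply: eq_bigr => k _; rewrite !dmxE (partialM (dF a k) (dG k b)).
Qed.

Lemma dmx_tr m p i (F : 'rV[R]_n -> 'M[R]_(m, p)) x :
  dmx i (fun y => (F y)^T) x = (dmx i F x)^T.
Proof.
apply/matrixP => a b; rewrite [RHS]mxE !dmxE.
have -> : (fun y => (F y)^T a b) = (fun y => F y b a).
  by apply/funext => y; rewrite mxE.
by [].
Qed.

Lemma Ck_derivable_mx m p U k i (F : 'rV[R]_n -> 'M[R]_(m, p)) x :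
  Ck_matrix k.+1 U F -> U x -> derivable_mx i F x.
Proof. by move=> cF Ux a b; exact: (cF a b i).1. Qed.

Lemma Ck_dmx m p U k i (F : 'rV[R]_n -> 'M[R]_(m, p)) : open U ->
  Ck_matrix k.+1 U F -> Ck_matrix k U (dmx i F).
Proof.
move=> oU cF a b; apply: eq_Ck (Ck_partial i (cF a b)) => // y _.
by rewrite dmxE.
Qed.

Lemma schwarz_mx m p U i j (F : 'rV[R]_n -> 'M[R]_(m, p)) x : open U ->
  Ck_matrix 2 U F -> U x -> dmx i (dmx j F) x = dmx j (dmx i F) x.
Proof.
move=> oU cF Ux; apply/matrixP => a b.
have E k l : dmx k (dmx l F) x a b = partial k (partial l (fun y => F y a b)) x.
  rewrite dmxE; congr (partial _ _ _); apply/funext => y; exact: dmxE.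
exact: (etrans (E i j) (etrans (schwarz i j oU (cF a b) Ux) (esym (E j i)))).
Qed.

Lemma Ck_addmx m p U k (F G : 'rV[R]_n -> 'M[R]_(m, p)) : open U ->
  Ck_matrix k U F -> Ck_matrix k U G -> Ck_matrix k U (fun x => F x + G x).
Proof.
move=> oU cF cG a b; apply: eq_Ck (Ck_add oU (cF a b) (cG a b)) => // y _.
by rewrite mxE.
Qed.

Lemma Ck_oppmx m p U k (F : 'rV[R]_n -> 'M[R]_(m, p)) : open U ->
  Ck_matrix k U F -> Ck_matrix k U (fun x => - F x).
Proof.
move=> oU cF a b; apply: eq_Ck (Ck_opp oU (cF a b)) => // y _.
by rewrite mxE.
Qed.

Lemma CkS_matrix m p U k (F : 'rV[R]_n -> 'M[R]_(m, p)) : open U ->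
  Ck_matrix k.+1 U F -> Ck_matrix k U F.
Proof. by move=> oU cF a b; apply: CkS. Qed.

End matrix_derivative.

(* Gam b x c a stands for Gamma^c_{ab}(x) and H for the inverse metric g^-1, so
   that H_parallel reads nabla g^-1 = 0. *)
Section connection.
Variables (R : realType) (n : nat) (U : set 'rV[R]_n).
Variables (H : 'rV[R]_n -> 'M[R]_n) (Gam : 'I_n -> 'rV[R]_n -> 'M[R]_n).
Hypothesis oU : open U.
Hypothesis H_C2 : Ck_matrix 2 U H.
Hypothesis Gam_C2 : forall a, Ck_matrix 2 U (Gam a).
Hypothesis H_sym : forall x, U x -> (H x)^T = H x.
Hypothesis Gam_sym : forall a b c x, U x -> Gam b x c a = Gam a x c b.
Hypothesis H_parallel : forall a x, U x ->
  dmx a H x = - (Gam a x *m H x) - H x *m (Gam a x)^T.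

(** The entry i, j is R^i_{jbc}: matrix products contract the connection indices, while the two form
    indices b and c remain parameters. *)
Definition curvature b c x : 'M[R]_n :=
  dmx b (Gam c) x - dmx c (Gam b) x + (Gam b x *m Gam c x - Gam c x *m Gam b x).

Definition raised_curvature b c x : 'M[R]_n := curvature b c x *m H x.

(** R^{cf}_{bc}: contracting with the second form index, rather than the first, reproduces the sign
    convention of [ricci]. *)
Definition mixed_ricci x : 'M[R]_n :=
  \matrix_(f, b) \sum_c raised_curvature b c x c f.

Let dH a x : U x -> derivable_mx a H x.
Proof. exact: Ck_derivable_mx H_C2. Qed.
Let dGam a b x : U x -> derivable_mx a (Gam b) x.
Proof. exact: Ck_derivable_mx (Gam_C2 b). Qed.
Let ddGam a b c x : U x -> derivable_mx a (dmx b (Gam c)) x.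
Proof. exact: (Ck_derivable_mx (Ck_dmx b oU (Gam_C2 c))). Qed.

(** Unlike [mxE], these expand sums and opposites but no products. After the noncommutative
    expansion, the entries of the product matrices are then atoms for [lra] and [ring]. *)
Let addE m p (A B : 'M[R]_(m, p)) i j : (A + B) i j = A i j + B i j.
Proof. by rewrite mxE. Qed.
Let oppE m p (A : 'M[R]_(m, p)) i j : (- A) i j = - A i j.
Proof. by rewrite mxE. Qed.

Let trD m p (A B : 'M[R]_(m, p)) : (A + B)^T = A^T + B^T.
Proof. by apply/matrixP => i j; rewrite !mxE. Qed.
Let trN m p (A : 'M[R]_(m, p)) : (- A)^T = - A^T.
Proof. by apply/matrixP => i j; rewrite !mxE. Qed.

Lemma curvature_C1 b c : Ck_matrix 1 U (curvature b c).
Proof.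
have cG a := CkS_matrix oU (Gam_C2 a).
have cD a d : Ck_matrix 1 U (dmx a (Gam d)) by exact: (Ck_dmx a oU (Gam_C2 d)).
apply: (Ck_addmx oU (Ck_addmx oU (cD b c) (Ck_oppmx oU (cD c b)))).
exact: (Ck_addmx oU (Ck_mulmx oU (cG b) (cG c))
         (Ck_oppmx oU (Ck_mulmx oU (cG c) (cG b)))).
Qed.

Lemma raised_curvature_C1 b c : Ck_matrix 1 U (raised_curvature b c).
Proof. exact: (Ck_mulmx oU (curvature_C1 b c) (CkS_matrix oU H_C2)). Qed.

Lemma curvature_skew b c x : curvature b c x = - curvature c b x.
Proof.
rewrite /curvature !opprD !opprK addrC [X in _ + X]addrC addrC.
by congr (_ + _); rewrite addrC.
Qed.

Lemma raised_curvature_skew b c x :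
  raised_curvature b c x = - raised_curvature c b x.
Proof. by rewrite /raised_curvature curvature_skew mulNmx. Qed.

(* The second derivatives of the parallel field H commute. *)
Lemma raised_curvature_antisym b c x : U x ->
  (raised_curvature b c x)^T = - raised_curvature b c x.
Proof.
move=> Ux.
have E p q : dmx p (dmx q H) x =
   - (dmx p (Gam q) x *m H x + Gam q x *m dmx p H x)
   - (dmx p H x *m (Gam q x)^T + H x *m (dmx p (Gam q) x)^T).
  rewrite (eq_dmx _ oU (G := fun y => 0 - Gam q y *m H y - H y *m (Gam q y)^T)) //; last first.
    by move=> y Uy; rewrite H_parallel // sub0r.
  have dGH : derivable_mx p (fun y => Gam q y *m H y) x.
    exact: (derivable_mxM (dGam Ux) (dH Ux)).
  have dGt : derivable_mx p (fun y => (Gam q y)^T) x.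
    move=> i j; have -> : (fun y => (Gam q y)^T i j) = (fun y => Gam q y j i).
      by apply/funext => y; rewrite mxE.
    exact: dGam.
  have dHG : derivable_mx p (fun y => H y *m (Gam q y)^T) x.
    exact: (derivable_mxM (dH Ux) dGt).
  have d0 : derivable_mx p (fun _ : 'rV[R]_n => 0 : 'M[R]_n) x.
    by move=> i j; exact: derivable_cst.
  rewrite (dmxB (derivable_mxB d0 dGH) dHG) (dmxB d0 dGH).
  have -> : dmx p (fun _ : 'rV[R]_n => 0 : 'M[R]_n) x = 0.
    by apply/matrixP => i j; rewrite dmxE mxE; exact: partial_cst.
  by rewrite sub0r (dmxM (dGam Ux) (dH Ux)) (dmxM (dH Ux) dGt) dmx_tr.
have := schwarz_mx b c oU H_C2 Ux; rewrite !E !H_parallel //.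
rewrite /raised_curvature trmx_mul H_sym //.
rewrite /curvature !(trD, trN, trmx_mul).
rewrite !(mulmxDl, mulmxDr, mulmxN, mulNmx, mulmxA).
move/matrixP => e.
apply/matrixP => i j; move: (e i j).
rewrite !(addE, oppE) => {}e.
lra.
Qed.

(** The identity dF + [A, F] = 0 for the curvature of the connection matrices: second derivatives
    cancel by Schwarz, terms with one derivative cancel in pairs, and cubic terms by the Jacobi
    identity. [D] is the covariant derivative in the matrix indices only. *)
Lemma second_bianchi a b c x : U x ->
  let D a b c := dmx a (curvature b c) x +
    (Gam a x *m curvature b c x - curvature b c x *m Gam a x) in
  D a b c + D b c a + D c a b = 0.
Proof.
move=> Ux D.
have E p q r : dmx p (curvature q r) x =
   dmx p (dmx q (Gam r)) x - dmx p (dmx r (Gam q)) x +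
   ((dmx p (Gam q) x *m Gam r x + Gam q x *m dmx p (Gam r) x) -
    (dmx p (Gam r) x *m Gam q x + Gam r x *m dmx p (Gam q) x)).
  have dM s t : derivable_mx p (fun y => Gam s y *m Gam t y) x.
    exact: (derivable_mxM (dGam Ux) (dGam Ux)).
  have dd s t : derivable_mx p (dmx s (Gam t)) x by exact: (ddGam Ux).
  rewrite (dmxD (derivable_mxB (dd q r) (dd r q)) (derivable_mxB (dM q r) (dM r q))).
  rewrite (dmxB (dd q r) (dd r q)) (dmxB (dM q r) (dM r q)).
  rewrite (dmxM (dGam (b := q) Ux) (dGam (b := r) Ux)).
  by rewrite (dmxM (dGam (b := r) Ux) (dGam (b := q) Ux)).
rewrite /D !E (schwarz_mx b a oU (Gam_C2 _) Ux) (schwarz_mx c a oU (Gam_C2 _) Ux).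
rewrite (schwarz_mx c b oU (Gam_C2 _) Ux) /curvature.
rewrite !(mulmxDl, mulmxDr, mulmxN, mulNmx, mulmxA).
apply/matrixP => i j; rewrite [RHS]mxE !(addE, oppE).
ring.
Qed.

Lemma derivable_raised a b c x : U x -> derivable_mx a (raised_curvature b c) x.
Proof. exact: (Ck_derivable_mx (raised_curvature_C1 b c)). Qed.

(** Covariant derivative of R^{ij}_{bc} in the upper indices only. The connection terms in b and c
    are left out: for a symmetric connection they cancel in the cyclic sum. *)
Let cov a b c x : 'M[R]_n := dmx a (raised_curvature b c) x +
  (Gam a x *m raised_curvature b c x + raised_curvature b c x *m (Gam a x)^T).

(** As [H] is parallel, raising an index commutes with covariant differentiation, so each [cov] is
    the corresponding term of [second_bianchi] multiplied by [H]. *)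
Lemma raised_bianchi a b c x : U x -> cov a b c x + cov b c a x + cov c a b x = 0.
Proof.
move=> Ux; have dR p q r := Ck_derivable_mx (i := p) (curvature_C1 q r) Ux.
have E p q r : cov p q r x = (dmx p (curvature q r) x +
    (Gam p x *m curvature q r x - curvature q r x *m Gam p x)) *m H x.
  rewrite /cov (dmxM (dR p q r) (dH Ux)) H_parallel // /raised_curvature.
  rewrite !(mulmxDl, mulmxDr, mulmxN, mulNmx, mulmxA).
  apply/matrixP => i j; rewrite !(addE, oppE).
  ring.
by rewrite !E -!mulmxDl (second_bianchi _ _ _ Ux) mul0mx.
Qed.

Lemma cov_skew a b c x : U x -> cov a b c x = - cov a c b x.
Proof.
move=> Ux; rewrite /cov raised_curvature_skew.
rewrite (eq_dmx _ oU (fun y _ => raised_curvature_skew b c y) Ux).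
rewrite (dmxN (derivable_raised Ux)) mulmxN mulNmx.
by rewrite !opprD.
Qed.

Lemma cov_antisym a b c x : U x -> (cov a b c x)^T = - cov a b c x.
Proof.
move=> Ux; rewrite /cov !trD -dmx_tr.
rewrite (eq_dmx _ oU (fun y Uy => raised_curvature_antisym b c Uy) Ux).
rewrite (dmxN (derivable_raised (b := b) (c := c) Ux)).
have := raised_curvature_antisym b c Ux.
move: (raised_curvature b c x) => P Pt; rewrite !trmx_mul trmxK Pt.
by rewrite mulmxN mulNmx !opprD [X in _ + X]addrC.
Qed.

Lemma dmx_mixed_ricci a f b x : U x ->
  dmx a mixed_ricci x f b = \sum_c dmx a (raised_curvature b c) x c f.
Proof.
move=> Ux; rewrite dmxE.
have -> : (fun y => mixed_ricci y f b) = (fun y => \sum_c raised_curvature b c y c f).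
  by apply/funext => y; rewrite mxE.
have dd c : derivable_mx a (raised_curvature b c) x by exact: (derivable_raised Ux).
rewrite (partial_sum _ (fun c _ => dd c c f)).2.
by apply: eq_bigr => c _; rewrite dmxE.
Qed.

(** This is dR = 2 div Ric, from the entries c, b of [raised_bianchi] summed over b and c. The
    connection term of the divergence for its lower index a stands on the left, hence with a plus
    sign. *)
Lemma contracted_bianchi a x : U x ->
  \sum_b dmx a mixed_ricci x b b +
    2 * (\sum_c \sum_e Gam a x c e * mixed_ricci x e c) =
  2 * (\sum_b dmx b mixed_ricci x b a +
       \sum_e \sum_b Gam b x b e * mixed_ricci x e a).
Proof.
move=> Ux.
pose P b c := raised_curvature b c x; pose Q := mixed_ricci x.
have Ps b c i j : P b c i j = - P c b i j.
  by rewrite /P raised_curvature_skew oppE.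
have Pa b c i j : P b c i j = - P b c j i.
  by have /matrixP/(_ j i) := raised_curvature_antisym b c Ux; rewrite mxE oppE.
have QE e c : Q e c = \sum_b P c b b e by rewrite /Q mxE.
have T1 : \sum_b \sum_c cov a b c x c b = \sum_b dmx a mixed_ricci x b b +
    2 * (\sum_c \sum_e Gam a x c e * Q e c).
  have -> : 2 * (\sum_c \sum_e Gam a x c e * Q e c) =
      \sum_b \sum_c (Gam a x *m P b c) c b + \sum_b \sum_c (P b c *m (Gam a x)^T) c b.
    rewrite mulr_natl mulr2n; congr (_ + _).
      rewrite [RHS]exchange_big /=; apply: eq_bigr => c _.
      under [RHS]eq_bigr => b _ do rewrite mxE.
      rewrite exchange_big /=; apply: eq_bigr => e _.
      rewrite QE mulr_sumr; apply: eq_bigr => b _.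
      by rewrite Ps Pa opprK.
    apply: eq_bigr => b _.
    under [RHS]eq_bigr => c _ do rewrite mxE.
    rewrite exchange_big /=; apply: eq_bigr => e _.
    rewrite QE mulr_sumr; apply: eq_bigr => c _.
    by rewrite mulrC; congr (_ * _); rewrite mxE.
  rewrite -!big_split; apply: eq_bigr => b _ /=.
  rewrite dmx_mixed_ricci // -!big_split; apply: eq_bigr => c _ /=.
  by rewrite /cov !addE.
have T2 : \sum_b \sum_c cov b c a x c b = - (\sum_b dmx b mixed_ricci x b a +
       \sum_e \sum_b Gam b x b e * Q e a).
  (* Gamma^c_{eb} is symmetric in e and b, the raised curvature antisymmetric in them, so the sum
     equals its opposite. *)
  have Z : \sum_b \sum_c (Gam b x *m P c a) c b = 0.
    have E : \sum_b \sum_c (Gam b x *m P c a) c b =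
        \sum_b \sum_e \sum_c Gam b x c e * P c a e b.
      apply: eq_bigr => b _; rewrite exchange_big; apply: eq_bigr => c _ /=.
      by rewrite mxE.
    have : \sum_b \sum_c (Gam b x *m P c a) c b = - \sum_b \sum_c (Gam b x *m P c a) c b.
      rewrite {1}E exchange_big /= E -sumrN; apply: eq_bigr => e _.
      rewrite -sumrN; apply: eq_bigr => b _; rewrite -sumrN; apply: eq_bigr => c _.
      by rewrite Gam_sym // Pa mulrN.
    by move=> h; lra.
  have -> : \sum_e \sum_b Gam b x b e * Q e a =
      - \sum_b \sum_c (P c a *m (Gam b x)^T) c b.
    rewrite exchange_big -sumrN; apply: eq_bigr => b _ /=.
    under [X in - X]eq_bigr => c _ do rewrite mxE.
    rewrite exchange_big -sumrN; apply: eq_bigr => e _ /=.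
    rewrite QE mulr_sumr -sumrN; apply: eq_bigr => c _.
    by rewrite Ps mulrN mulrC; congr (- (_ * _)); rewrite mxE.
  rewrite opprD opprK -sumrN.
  apply: etrans (etrans (congr1 (fun z => _ + z) Z) (addr0 _)).
  rewrite -!big_split; apply: eq_bigr => b _ /=.
  rewrite dmx_mixed_ricci // -sumrN -!big_split; apply: eq_bigr => c _ /=.
  rewrite (eq_dmx _ oU (fun y _ => raised_curvature_skew a c y) Ux).
  rewrite (dmxN (derivable_raised Ux)) oppE opprK /cov !addE -/(P c a).
  by rewrite -addrA; congr (_ + _); exact: addrC.
(* The third cyclic term repeats the second: exchange b and c, then use antisymmetry in the lower
   and in the upper pair. *)
have T3 : \sum_b \sum_c cov c a b x c b = \sum_b \sum_c cov b c a x c b.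
  rewrite exchange_big; apply: eq_bigr => b _ /=; apply: eq_bigr => c _ /=.
  by rewrite cov_skew // -cov_antisym // mxE.
have : \sum_b \sum_c (cov a b c x + cov b c a x + cov c a b x) c b = 0.
  rewrite big1 // => b _; rewrite big1 // => c _.
  by rewrite raised_bianchi // mxE.
have -> : \sum_b \sum_c (cov a b c x + cov b c a x + cov c a b x) c b =
  \sum_b \sum_c cov a b c x c b + \sum_b \sum_c cov b c a x c b +
  \sum_b \sum_c cov c a b x c b.
  rewrite -!big_split; apply: eq_bigr => b _ /=; rewrite -!big_split.
  by apply: eq_bigr => c _ /=; rewrite !addE.
rewrite T3 T1 T2 -/Q.
set u := \sum_b dmx _ _ _ b b; set v := \sum_c \sum_e _; set w := \sum_b _ + _.
move=> h; lra.
Qed.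

End connection.

(** * The Levi-Civita connection and the conservation of the Einstein tensor *)

Section levi_civita.
Variables (R : realType) (n : nat) (U : set 'rV[R]_n) (g : 'rV[R]_n -> 'M[R]_n).
Hypothesis oU : open U.
Hypothesis g_C3 : Ck_matrix 3 U g.
Hypothesis g_sym : forall x, U x -> (g x)^T = g x.
Hypothesis g_unit : forall x, U x -> g x \in unitmx.

Definition christoffel_mx (a : 'I_n) (x : 'rV[R]_n) : 'M[R]_n :=
  \matrix_(c, d) christoffel g c d a x.

Let H x := invmx (g x).

(** Christoffel symbols of the first kind. *)
Let lowered (a : 'I_n) (x : 'rV[R]_n) : 'M[R]_n :=
  \matrix_(k, d) (2^-1 * (dmx d g x k a + dmx a g x k d - dmx k g x d a)).

Lemma christoffel_mxE a x : christoffel_mx a x = H x *m lowered a x.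
Proof.
apply/matrixP => c d; rewrite [LHS]mxE [RHS]mxE /christoffel mulr_sumr.
by apply: eq_bigr => k _; rewrite [X in _ = _ * X]mxE !dmxE mulrCA.
Qed.

Lemma dmx_metric_sym a i j x : U x -> dmx a g x i j = dmx a g x j i.
Proof.
by move=> Ux; rewrite -[in LHS](eq_dmx a oU g_sym Ux) dmx_tr mxE.
Qed.

Lemma christoffel_mx_sym a b c x : U x ->
  christoffel_mx b x c a = christoffel_mx a x c b.
Proof.
move=> Ux; rewrite !christoffel_mxE !mxE; apply: eq_bigr => k _.
rewrite [X in _ * X]mxE [X in _ = _ * X]mxE (dmx_metric_sym k a b Ux).
by congr (_ * (_ * (_ - _))); exact: addrC.
Qed.

Lemma christoffel_sym a b c x : U x -> christoffel g c a b x = christoffel g c b a x.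
Proof. by move=> Ux; have := christoffel_mx_sym a b c Ux; rewrite !mxE. Qed.

Lemma invmx_metric_C3 : Ck_matrix 3 U H.
Proof. exact: (Ck_invmx oU g_unit g_C3). Qed.

Lemma christoffel_mx_C2 a : Ck_matrix 2 U (christoffel_mx a).
Proof.
have dg k i j : Ck 2 U (fun y => dmx k g y i j) by exact: (Ck_dmx k oU g_C3 i j).
have cL : Ck_matrix 2 U (lowered a).
  move=> k d; apply: (eq_Ck oU _ (Ck_scale 2^-1 oU (Ck_add oU
    (Ck_add oU (dg d k a) (dg a k d)) (Ck_opp oU (dg k d a))))).
  by move=> y _; rewrite mxE.
have cHL := Ck_mulmx oU (CkS_matrix oU invmx_metric_C3) cL.
by move=> i j; apply: (eq_Ck oU _ (cHL i j)) => y _; rewrite christoffel_mxE.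
Qed.

Lemma invmx_metric_sym x : U x -> (H x)^T = H x.
Proof. by move=> Ux; rewrite /H trmx_inv g_sym. Qed.

(** The product of g with the connection matrix is the matrix of symbols of the first kind; adding
    its transpose leaves only the derivative along a. *)
Lemma metric_compatible a x : U x ->
  dmx a g x = g x *m christoffel_mx a x + (christoffel_mx a x)^T *m g x.
Proof.
move=> Ux; have gL : g x *m christoffel_mx a x = lowered a x.
  by rewrite christoffel_mxE /H mulKVmx // g_unit.
have -> : (christoffel_mx a x)^T *m g x = (lowered a x)^T.
  by rewrite -gL trmx_mul g_sym.
rewrite gL; apply/matrixP => i j.
rewrite [RHS]mxE [X in X + _]mxE [X in _ + X]mxE [X in _ + X]mxE.
rewrite (dmx_metric_sym a j i Ux) (dmx_metric_sym j i a Ux) (dmx_metric_sym i j a Ux).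
move: (dmx j g x a i) (dmx a g x i j) (dmx i g x a j) => p q r.
lra.
Qed.

(** Differentiate g g^-1 = 1. *)
Lemma dmx_invmx a x : U x -> dmx a H x = - (H x *m dmx a g x *m H x).
Proof.
move=> Ux.
have dH := Ck_derivable_mx (i := a) invmx_metric_C3 Ux.
have dg := Ck_derivable_mx (i := a) g_C3 Ux.
have : dmx a (fun y => g y *m H y) x = 0.
  rewrite (eq_dmx a oU (G := fun=> 1%:M) (fun y Uy => mulmxV (g_unit Uy)) Ux).
  by apply/matrixP => i j; rewrite dmxE [RHS]mxE; exact: partial_cst.
rewrite (dmxM dg dH) => /(congr1 (fun M => H x *m M)).
rewrite mulmxDr mulmx0 mulmxA (mulKmx (g_unit Ux)) => e.
by apply/eqP; rewrite -addr_eq0 addrC e.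
Qed.

Lemma invmx_metric_parallel a x : U x ->
  dmx a H x = - (christoffel_mx a x *m H x) - H x *m (christoffel_mx a x)^T.
Proof.
move=> Ux; rewrite dmx_invmx // metric_compatible // mulmxDr mulmxDl opprD.
rewrite (mulKmx (g_unit Ux)) -!mulmxA (mulmxV (g_unit Ux)) mulmx1.
by [].
Qed.

Let Q := mixed_ricci H christoffel_mx.

(** Ties the contraction of the abstract connection to the coordinate definition of [ricci], sign
    included. *)
Lemma mixed_ricciE x : U x -> Q x = H x *m ricci g x.
Proof.
move=> Ux; apply/matrixP => f b; rewrite [LHS]mxE [RHS]mxE.
have dG p q i j : dmx p (christoffel_mx q) x i j = partial p (christoffel g i j q) x.
  by rewrite dmxE; congr (partial _ _ _); apply/funext => y; rewrite mxE.
have E a : ricci g x a b = \sum_c curvature christoffel_mx b c x c a.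
  rewrite mxE -big_split; apply: eq_bigr => c _ /=.
  rewrite /curvature [RHS]mxE; congr (_ + _).
    by rewrite [RHS]mxE [X in _ = _ + X]mxE !dG.
  rewrite [RHS]mxE [X in _ = _ + X]mxE [X in _ = X - _]mxE [X in _ = _ - X]mxE.
  rewrite -sumrB; apply: eq_bigr => d _.
  by rewrite /christoffel_mx !mxE; congr (_ - _); rewrite mulrC.
under [RHS]eq_bigr => a _ do rewrite E mulr_sumr.
rewrite exchange_big; apply: eq_bigr => c _ /=.
rewrite /raised_curvature mxE; apply: eq_bigr => a _.
by rewrite mulrC -[in LHS](invmx_metric_sym Ux) mxE.
Qed.

Lemma scalar_curvatureE x : U x -> scalar_curvature g x = \sum_b Q x b b.
Proof.
move=> Ux; rewrite /scalar_curvature exchange_big; apply: eq_bigr => b _ /=.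
rewrite mixed_ricciE // mxE; apply: eq_bigr => a _.
by congr (_ * _); rewrite -(invmx_metric_sym Ux) mxE.
Qed.

(** In mixed components the trace term is a multiple of the identity matrix, so its divergence
    involves no derivative of the metric. *)
Definition mixed_einstein x : 'M[R]_n := invmx (g x) *m einstein g x.

Let trace_part x : 'M[R]_n := (2^-1 * \sum_b Q x b b)%:M.

Lemma mixed_einsteinE x : U x -> mixed_einstein x = Q x - trace_part x.
Proof.
move=> Ux; rewrite /mixed_einstein /einstein mulmxBr -mixed_ricciE //.
by rewrite -scalemxAr (mulVmx (g_unit Ux)) scalar_curvatureE // scalemx1.
Qed.

Lemma mixed_einstein_trace x : U x ->
  \sum_b mixed_einstein x b b = (1 - n%:R / 2) * scalar_curvature g x.
Proof.
move=> Ux; rewrite scalar_curvatureE //.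
under eq_bigr => b _ do rewrite mixed_einsteinE // mxE [X in _ + X]mxE [X in _ - X]mxE eqxx mulr1n.
rewrite sumrB sumr_const card_ord; move: (\sum_i _) => r.
by rewrite -mulr_natl; field.
Qed.

Lemma mixed_einstein_entry x i j : U x ->
  mixed_einstein x i j =
  (invmx (g x) *m ricci g x) i j - (2^-1 * scalar_curvature g x) *+ (i == j).
Proof.
move=> Ux; rewrite mixed_einsteinE // mixed_ricciE // scalar_curvatureE // [LHS]mxE.
by congr (_ + _); rewrite [LHS]mxE [X in - X]mxE.
Qed.

Lemma mixed_ricci_C1 : Ck_matrix 1 U Q.
Proof.
have cr b c := raised_curvature_C1 (n := n) oU (CkS_matrix oU invmx_metric_C3)
  christoffel_mx_C2 b c.
move=> f b; apply: (eq_Ck oU _ (Ck_sum (index_enum 'I_n) (P := xpredT) oU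
   (fun c _ => cr b c c f))) => y _.
by rewrite mxE.
Qed.

Lemma trace_part_C1 : Ck_matrix 1 U trace_part.
Proof.
have c0 := Ck_scale 2^-1 oU (Ck_sum (index_enum 'I_n) (P := xpredT) oU
   (fun b _ => mixed_ricci_C1 b b)).
move=> i j; case: (eqVneq i j) => [->|/negPf ij].
  by apply: (eq_Ck oU _ c0) => y _; rewrite mxE eqxx.
by apply: (eq_Ck oU _ (Ck_cst 1 0 oU)) => y _; rewrite mxE ij.
Qed.

Lemma mixed_einstein_C1 : Ck_matrix 1 U mixed_einstein.
Proof.
move=> i j; apply: (eq_Ck oU _ (Ck_addmx oU mixed_ricci_C1
   (Ck_oppmx oU trace_part_C1) i j)) => y Uy.
by rewrite mixed_einsteinE.
Qed.

Lemma dmx_trace_part a x i j : U x ->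
  dmx a trace_part x i j = (2^-1 * \sum_b dmx a Q x b b) *+ (i == j).
Proof.
move=> Ux; rewrite dmxE.
have dQ b := (mixed_ricci_C1 b b a).1 x Ux.
case: (eqVneq i j) => [->|/negPf ij].
  have -> : (fun y => trace_part y j j) = (fun y => 2^-1 * \sum_b Q y b b).
    by apply/funext => y; rewrite mxE eqxx.
  have [d e] := partial_sum (index_enum 'I_n) (P := xpredT) (fun b _ => dQ b).
  rewrite (partialZ _ d) mulr1n; congr (_ * _); rewrite e; apply: eq_bigr => b _.
  by rewrite dmxE.
have -> : (fun y => trace_part y i j) = (fun=> 0).
  by apply/funext => y; rewrite mxE ij.
by rewrite partial_cst.
Qed.

(** nabla_b G^b_a = 0 written out. The trace part subtracts dR / 2 from the divergence of the Ricci
    tensor, and its two connection terms, both multiples of Gamma^b_{ab}, cancel. *)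
Lemma einstein_conserved a x : U x ->
  \sum_b dmx b mixed_einstein x b a
  + \sum_e (\sum_b christoffel g b e b x) * mixed_einstein x e a
  - \sum_c \sum_e christoffel g c e a x * mixed_einstein x e c = 0.
Proof.
move=> Ux.
have := contracted_bianchi oU (CkS_matrix oU invmx_metric_C3) christoffel_mx_C2
  invmx_metric_sym christoffel_mx_sym invmx_metric_parallel a Ux.
rewrite -/Q.
have dQ b := Ck_derivable_mx (i := b) mixed_ricci_C1 Ux.
have dT b := Ck_derivable_mx (i := b) trace_part_C1 Ux.
have -> : \sum_b dmx b mixed_einstein x b a =
    \sum_b dmx b Q x b a - 2^-1 * \sum_b dmx a Q x b b.
  have E b : dmx b mixed_einstein x b a = dmx b Q x b a - dmx b trace_part x b a.
    by rewrite (eq_dmx b oU mixed_einsteinE Ux) (dmxB (dQ b) (dT b)) [LHS]mxE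
       [X in _ + X]mxE.
  under eq_bigr => b _ do rewrite E.
  have S : \sum_b dmx b trace_part x b a = 2^-1 * \sum_b dmx a Q x b b.
    rewrite (bigD1 a) //= dmx_trace_part // eqxx mulr1n [X in _ + X]big1 ?addr0 //.
    by move=> b /negPf ba; rewrite dmx_trace_part // ba.
  by rewrite -S -sumrB; apply: eq_bigr => b _.
have sum_delta (F : 'I_n -> R) t c : \sum_e F e * (t *+ (e == c)) = t * F c.
  rewrite (bigD1 c) //= eqxx mulr1n [X in _ + X]big1 ?addr0 1?mulrC //.
  by move=> e /negPf ->; rewrite mulr0n mulr0.
pose t : R := 2^-1 * \sum_b Q x b b.
have mE e c : mixed_einstein x e c = Q x e c - t *+ (e == c).
  rewrite mixed_einsteinE // mxE [X in _ + X]mxE; congr (_ - _).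
  by rewrite /trace_part mxE.
have -> : \sum_e (\sum_b christoffel g b e b x) * mixed_einstein x e a =
    \sum_e \sum_b christoffel_mx b x b e * Q x e a - t * \sum_b christoffel g b a b x.
  under eq_bigr => e _ do rewrite mE mulrBr.
  rewrite sumrB; congr (_ - _).
    apply: eq_bigr => e _; rewrite mulr_suml; apply: eq_bigr => b _.
    by congr (_ * _); rewrite mxE.
  exact: sum_delta.
have -> : \sum_c \sum_e christoffel g c e a x * mixed_einstein x e c =
    \sum_c \sum_e christoffel_mx a x c e * Q x e c - t * \sum_b christoffel g b a b x.
  rewrite mulr_sumr -sumrB; apply: eq_bigr => c _.
  under eq_bigr => e _ do rewrite mE mulrBr.
  rewrite sumrB; congr (_ - _).
    by apply: eq_bigr => e _; congr (_ * _); rewrite mxE.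
  rewrite sum_delta.
  have := christoffel_mx_sym a c c Ux; by rewrite !mxE => ->.
set A := \sum_b dmx a Q x b b; set B := \sum_b dmx b Q x b a.
set C := \sum_e \sum_b _; set D := \sum_c \sum_e _; set K := t * _.
move: A B C D K => A B C D K h; lra.
Qed.

End levi_civita.

(** * Static metrics *)

Section product_with_time.
Variables (R : realType) (n m : nat).
Implicit Types (f : 'rV[R]_n -> R) (X : 'rV[R]_(n + m)) (U : set 'rV[R]_n).

Definition cylinder U : set 'rV[R]_(n + m) := [set X | U (lsubmx X)].

Lemma open_cylinder U : open U -> open (cylinder U).
Proof.
move=> oU; apply: open_comp oU => X _.
exact: (differentiable_continuous (differentiable_lsubmx X)).
Qed.

(** The difference quotients coincide as functions of h, so derivability and the value of the
    derivative transfer together. *)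
Let space_incr f X i : (fun h : R => h^-1 *: (((fun Y => f (lsubmx Y)) \o shift X)
    (h *: delta_mx 0 (lshift m i)) - f (lsubmx X))) =
  (fun h : R => h^-1 *: ((f \o shift (lsubmx X)) (h *: delta_mx 0 i) - f (lsubmx X))).
Proof.
apply/funext => h /=; congr (_ *: (f _ - _)).
by apply/rowP => j; rewrite !mxE; congr (_ * _ + _); rewrite eq_lshift.
Qed.

Let time_incr f X k : (fun h : R => h^-1 *: (((fun Y => f (lsubmx Y)) \o shift X)
    (h *: delta_mx 0 (rshift n k)) - f (lsubmx X))) = (fun=> 0).
Proof.
apply/funext => h /=; have -> : lsubmx (h *: delta_mx 0 (rshift n k) + X) = lsubmx X.
  by apply/rowP => j; rewrite !mxE eq_lrshift andbF mulr0 add0r.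
by rewrite subrr scaler0.
Qed.

Lemma derivable_space f X i :
  derivable (fun Y => f (lsubmx Y)) X (delta_mx 0 (lshift m i)) <->
  derivable f (lsubmx X) (delta_mx 0 i).
Proof. by rewrite /derivable space_incr. Qed.

Lemma partial_space f X i :
  partial (lshift m i) (fun Y => f (lsubmx Y)) X = partial i f (lsubmx X).
Proof. by rewrite /partial /derive space_incr. Qed.

Lemma derivable_time f X k :
  derivable (fun Y => f (lsubmx Y)) X (delta_mx 0 (rshift n k)).
Proof. rewrite /derivable time_incr; exact: is_cvg_cst. Qed.

Lemma partial_time f X k : partial (rshift n k) (fun Y => f (lsubmx Y)) X = 0.
Proof. rewrite /partial /derive time_incr; exact: lim_cst. Qed.

Lemma Ck_cylinder k U f : open U -> Ck k U f ->
  Ck k (cylinder U) (fun Y => f (lsubmx Y)).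
Proof.
move=> oU; have oW := open_cylinder oU; elim: k f => [|k IH] f cf.
  move=> X WX; apply: (continuous_comp _ (cf _ WX)).
  exact: (differentiable_continuous (differentiable_lsubmx X)).
move=> i; case: (split_ordP i) => j -> {i}.
  split; first by move=> X WX; apply/derivable_space; exact: (cf j).1.
  apply: (eq_Ck oW _ (IH _ (cf j).2)) => X _; exact: esym (partial_space _ _ _).
split; first by move=> X _; exact: derivable_time.
apply: (eq_Ck oW _ (Ck_cst k 0 oW)) => X _; exact: esym (partial_time _ _ _).
Qed.

End product_with_time.

(** * Christoffel symbols and Ricci curvature of a static metric *)

Section static_geometry.
Variables (R : realType) (U : set 'rV[R]_3) (g : 'rV[R]_3 -> 'M[R]_3).
Variable omega : 'rV[R]_3 -> R.
Hypothesis oU : open U.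
Hypothesis g_C3 : Ck_matrix 3 U g.
Hypothesis g_sym : forall x, U x -> (g x)^T = g x.
Hypothesis g_unit : forall x, U x -> g x \in unitmx.
Hypothesis omega_C3 : Ck 3 U omega.

Local Notation N := (fun x => expR (omega x)).
Local Notation W := (cylinder (m := 1) U).
Local Notation G := (static_metric g omega).
Local Notation s i := (lshift 1 i).
Local Notation t := (rshift 3 (ord0 : 'I_1)).

Lemma lapse_neq0 x : N x != 0.
Proof. by rewrite gt_eqF // expR_gt0. Qed.

Lemma lapse_C3 : Ck 3 U N.
Proof. exact: Ck_expR. Qed.

Lemma sum_spacetime (F : 'I_(3 + 1) -> R) :
  \sum_a F a = \sum_i F (s i) + F t.
Proof. by rewrite big_split_ord /= big_ord1. Qed.

Lemma static_metric_ss X i j : G X (s i) (s j) = g (lsubmx X) i j.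
Proof. by rewrite /static_metric block_mxEul. Qed.
Lemma static_metric_st X i : G X (s i) t = 0.
Proof. by rewrite /static_metric block_mxEur mxE. Qed.
Lemma static_metric_ts X i : G X t (s i) = 0.
Proof. by rewrite /static_metric block_mxEdl mxE. Qed.
Lemma static_metric_tt X : G X t t = - N (lsubmx X).
Proof. by rewrite /static_metric block_mxEdr mxE. Qed.

Lemma static_metric_C3 : Ck_matrix 3 W G.
Proof.
have oW := open_cylinder (m := 1) oU.
move=> a b; case: (split_ordP a) => i ->; case: (split_ordP b) => j ->.
- apply: (eq_Ck oW _ (Ck_cylinder 1 oU (g_C3 i j))) => X _.
  by rewrite static_metric_ss.
- apply: (eq_Ck oW _ (Ck_cst 3 0 oW)) => X _; by rewrite [j]ord1 static_metric_st.
- apply: (eq_Ck oW _ (Ck_cst 3 0 oW)) => X _; by rewrite [i]ord1 static_metric_ts.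
- apply: (eq_Ck oW _ (Ck_cylinder 1 oU (Ck_opp oU lapse_C3))) => X _.
  by rewrite [i]ord1 [j]ord1 static_metric_tt.
Qed.

Lemma static_metric_sym X : W X -> (G X)^T = G X.
Proof.
move=> WX; rewrite /static_metric tr_block_mx !trmx0 g_sym //.
by rewrite tr_scalar_mx.
Qed.

Let Ginv (X : 'rV[R]_(3 + 1)) : 'M[R]_(3 + 1) :=
  block_mx (invmx (g (lsubmx X))) 0 0 (- (N (lsubmx X))^-1)%:M.

Lemma static_metric_mul X : W X -> Ginv X *m G X = 1%:M.
Proof.
move=> WX; rewrite /Ginv /static_metric mulmx_block !mulmx0 !mul0mx !addr0 !add0r.
rewrite (mulVmx (g_unit WX)) -scalar_mxM mulrNN mulVf ?lapse_neq0 //.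
by rewrite [RHS]scalar_mx_block.
Qed.

Lemma static_metric_unit X : W X -> G X \in unitmx.
Proof. by move=> /static_metric_mul /mulmx1_unit[]. Qed.

Lemma invmx_static_metric X : W X -> invmx (G X) = Ginv X.
Proof.
move=> WX; rewrite -[RHS](mulmxK (static_metric_unit WX)).
by rewrite static_metric_mul // mul1mx.
Qed.

Lemma invmx_static_ss X i j : W X -> invmx (G X) (s i) (s j) = invmx (g (lsubmx X)) i j.
Proof. by move=> WX; rewrite invmx_static_metric // block_mxEul. Qed.
Lemma invmx_static_st X i : W X -> invmx (G X) (s i) t = 0.
Proof. by move=> WX; rewrite invmx_static_metric // block_mxEur mxE. Qed.
Lemma invmx_static_ts X i : W X -> invmx (G X) t (s i) = 0.
Proof. by move=> WX; rewrite invmx_static_metric // block_mxEdl mxE. Qed.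
Lemma invmx_static_tt X : W X -> invmx (G X) t t = - (N (lsubmx X))^-1.
Proof. by move=> WX; rewrite invmx_static_metric // block_mxEdr mxE. Qed.

Let pG_ss k i j X :
  partial (s k) (fun Y => G Y (s i) (s j)) X = partial k (fun y => g y i j) (lsubmx X).
Proof.
rewrite -partial_space; congr (partial _ _ _).
by apply/funext => Y; rewrite static_metric_ss.
Qed.
Let pG_st b i X : partial b (fun Y => G Y (s i) t) X = 0.
Proof.
have -> : (fun Y => G Y (s i) t) = (fun=> 0).
  by apply/funext => Y; rewrite static_metric_st.
exact: partial_cst.
Qed.
Let pG_ts b i X : partial b (fun Y => G Y t (s i)) X = 0.
Proof.
have -> : (fun Y => G Y t (s i)) = (fun=> 0).
  by apply/funext => Y; rewrite static_metric_ts.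
exact: partial_cst.
Qed.
Let pG_tt k X : W X ->
  partial (s k) (fun Y => G Y t t) X = - partial k N (lsubmx X).
Proof.
move=> WX; rewrite -(partialN ((lapse_C3 k).1 _ WX)) -partial_space.
by congr (partial _ _ _); apply/funext => Y; rewrite static_metric_tt.
Qed.
Let pG_time a b X : partial t (fun Y => G Y a b) X = 0.
Proof.
case: (split_ordP a) => i ->; case: (split_ordP b) => j ->.
- have -> : (fun Y => G Y (s i) (s j)) = (fun Y => g (lsubmx Y) i j).
    by apply/funext => Y; rewrite static_metric_ss.
  exact: (partial_time (fun y => g y i j)).
- by rewrite [j]ord1 pG_st.
- by rewrite [i]ord1 pG_ts.
- rewrite [i]ord1 [j]ord1.
  have -> : (fun Y => G Y t t) = (fun Y => - N (lsubmx Y)).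
    by apply/funext => Y; rewrite static_metric_tt.
  exact: (partial_time (fun y => - N y)).
Qed.

Definition raised_gradient (f : 'rV[R]_3 -> R) (k : 'I_3) x :=
  \sum_d invmx (g x) k d * partial d f x.

Lemma christoffel_sss k i j X : W X ->
  christoffel G (s k) (s i) (s j) X = christoffel g k i j (lsubmx X).
Proof.
move=> WX; rewrite /christoffel sum_spacetime invmx_static_st // mul0r addr0.
congr (_ * _); apply: eq_bigr => d _; rewrite invmx_static_ss //.
by rewrite !pG_ss.
Qed.

Lemma christoffel_sts k i X : W X -> christoffel G (s k) t (s i) X = 0.
Proof.
move=> WX; rewrite /christoffel sum_spacetime invmx_static_st // mul0r addr0.
rewrite big1 ?mulr0 // => d _; rewrite pG_time pG_st pG_ts.
by rewrite !(addr0, oppr0, mulr0).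
Qed.

Lemma christoffel_stt k X : W X ->
  christoffel G (s k) t t X = 2^-1 * raised_gradient N k (lsubmx X).
Proof.
move=> WX; rewrite /christoffel sum_spacetime invmx_static_st // mul0r addr0.
congr (_ * _); apply: eq_bigr => d _; rewrite invmx_static_ss //.
by rewrite pG_time addr0 sub0r pG_tt // opprK.
Qed.

Lemma christoffel_tst i X : W X ->
  christoffel G t (s i) t X = 2^-1 * ((N (lsubmx X))^-1 * partial i N (lsubmx X)).
Proof.
move=> WX; rewrite /christoffel sum_spacetime big1 => [|d _]; last first.
  by rewrite invmx_static_ts // mul0r.
by rewrite add0r invmx_static_tt // pG_tt // !pG_time !(subr0, addr0, add0r) mulrNN.
Qed.

Lemma christoffel_tts i X : W X ->
  christoffel G t t (s i) X = 2^-1 * ((N (lsubmx X))^-1 * partial i N (lsubmx X)).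
Proof.
move=> WX; rewrite /christoffel sum_spacetime big1 => [|d _]; last first.
  by rewrite invmx_static_ts // mul0r.
by rewrite add0r invmx_static_tt // pG_tt // !pG_time !(subr0, addr0, add0r) mulrNN.
Qed.

Lemma christoffel_ttt X : W X -> christoffel G t t t X = 0.
Proof.
move=> WX; rewrite /christoffel sum_spacetime big1 => [|d _]; last first.
  by rewrite invmx_static_ts // mul0r.
by rewrite !pG_time !(addr0, oppr0, mulr0).
Qed.

(* The partial derivatives of log (sqrt |det G|). *)
Definition volume_gradient (j : 'I_3) x :=
  \sum_k christoffel g k j k x + 2^-1 * ((N x)^-1 * partial j N x).

Lemma christoffel_trace j X : W X ->
  \sum_b christoffel G b (s j) b X = volume_gradient j (lsubmx X).
Proof.
move=> WX; rewrite sum_spacetime christoffel_tst //; congr (_ + _).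
by apply: eq_bigr => k _; rewrite christoffel_sss.
Qed.

(** Kept in terms of N = e^omega and of [volume_gradient]: the last sum then has the shape of the
    connection term of Maxwell's equation, with which it is later combined. *)
Lemma ricci_tt X : W X -> ricci G X t t =
  - (2^-1 * \sum_k partial k (raised_gradient N k) (lsubmx X))
  + 2^-1 * \sum_k (N (lsubmx X))^-1 * partial k N (lsubmx X) * raised_gradient N k (lsubmx X)
  - 2^-1 * \sum_k raised_gradient N k (lsubmx X) * volume_gradient k (lsubmx X).
Proof.
move=> WX; have oW := open_cylinder (m := 1) oU.
have rN k : Ck 2 U (raised_gradient N k).
  have cH := CkS_matrix oU (invmx_metric_C3 oU g_C3 g_unit).
  by apply: (Ck_sum (index_enum 'I_3) (P := xpredT) oU) => d _;
     exact: (Ck_mul oU (cH k d) (lapse_C3 d).2).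
rewrite /ricci mxE.
have z1 : \sum_c (partial t (christoffel G c t c) X - partial c (christoffel G c t t) X) =
    - (2^-1 * \sum_k partial k (raised_gradient N k) (lsubmx X)).
  rewrite sum_spacetime (eq_partial _ oW (@christoffel_ttt) WX) !partial_cst subr0 addr0.
  rewrite mulr_sumr -sumrN; apply: eq_bigr => k _.
  rewrite (eq_partial _ oW (christoffel_sts k k) WX) partial_cst sub0r; congr (- _).
  rewrite (eq_partial _ oW (@christoffel_stt k) WX) -(partialZ _ ((rN k k).1 _ WX)).
  exact: (partial_space (fun y => 2^-1 * raised_gradient N k y)).
have z2 : \sum_c \sum_d (christoffel G d t c X * christoffel G c d t X) =
    2^-1 * \sum_k (N (lsubmx X))^-1 * partial k N (lsubmx X) * raised_gradient N k (lsubmx X).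
  rewrite sum_spacetime [X in _ + X]sum_spacetime christoffel_ttt // mul0r addr0.
  rewrite -big_split /= mulr_sumr; apply: eq_bigr => k _.
  rewrite sum_spacetime christoffel_tts // christoffel_stt // christoffel_tst //.
  rewrite big1 => [|d _]; last by rewrite christoffel_sts // mul0r.
  move: ((N (lsubmx X))^-1 * partial k N (lsubmx X)) (raised_gradient _ _ _) => y z.
  by field.
have z3 : \sum_c \sum_d (christoffel G d t t X * christoffel G c d c X) =
    2^-1 * \sum_k raised_gradient N k (lsubmx X) * volume_gradient k (lsubmx X).
  rewrite exchange_big sum_spacetime /=.
  rewrite [X in _ + X]big1 ?addr0 => [|c _]; last by rewrite christoffel_ttt // mul0r.
  rewrite mulr_sumr; apply: eq_bigr => k _.
  by rewrite -mulr_sumr christoffel_trace // christoffel_stt // mulrA.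
under [X in _ + X]eq_bigr => c _ do rewrite sumrB.
by rewrite z1 sumrB z2 z3 addrA.
Qed.

End static_geometry.

(** * The charged fluid *)

Section charged_fluid.
Variables (R : realType) (U : set 'rV[R]_3) (g : 'rV[R]_3 -> 'M[R]_3).
Variables (omega phi p rho sigma : 'rV[R]_3 -> R) (kappa : R).
Hypothesis oU : open U.
Hypothesis kappa_gt0 : 0 < kappa.
Hypothesis g_C3 : Ck_matrix 3 U g.
Hypothesis g_sym : forall x, U x -> (g x)^T = g x.
Hypothesis g_unit : forall x, U x -> g x \in unitmx.
Hypothesis omega_C3 : Ck 3 U omega.
Hypothesis phi_C2 : Ck 2 U phi.

Local Notation N := (fun x => expR (omega x)).
Local Notation W := (cylinder (m := 1) U).
Local Notation G := (static_metric g omega).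
Local Notation F := (electric_field phi).
Local Notation s i := (lshift 1 i).
Local Notation t := (rshift 3 (ord0 : 'I_1)).

Hypothesis field_eqs : forall X, W X -> einstein_maxwell kappa g omega phi
  (p (lsubmx X)) (rho (lsubmx X)) (sigma (lsubmx X)) X.

Definition field_strength2 x : R :=
  (grad phi x *m invmx (g x) *m (grad phi x)^T) 0 0.

Local Notation v k := (raised_gradient g phi k).
Local Notation q := field_strength2.

Let H_sym x : U x -> (invmx (g x))^T = invmx (g x).
Proof. by move=> Ux; rewrite trmx_inv g_sym. Qed.

Lemma raised_gradientE f k x :
  raised_gradient g f k x = (invmx (g x) *m (grad f x)^T) k 0.
Proof. by rewrite mxE; apply: eq_bigr => d _; rewrite !mxE. Qed.

Lemma field_strength2E x : q x = \sum_k partial k phi x * v k x.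
Proof.
rewrite /q -mulmxA mxE; apply: eq_bigr => k _.
by rewrite raised_gradientE; congr (_ * _); rewrite mxE.
Qed.

Lemma raise_st X i : W X -> raise G F X (s i) t =
  - ((N (lsubmx X))^-1 * v i (lsubmx X)).
Proof.
move=> WX; rewrite /raise (invmx_static_metric omega g_unit WX) /electric_field.
rewrite tr_block_mx !mulmx_block !trmx0 !(mulmx0, mul0mx, addr0, add0r) block_mxEur.
by rewrite tr_scalar_mx mul_mx_scalar mxE raised_gradientE mulNr.
Qed.

Lemma raise_ts X i : W X -> raise G F X t (s i) = (N (lsubmx X))^-1 * v i (lsubmx X).
Proof.
move=> WX; rewrite /raise (invmx_static_metric omega g_unit WX) /electric_field.
rewrite tr_block_mx !mulmx_block !trmx0 !(mulmx0, mul0mx, addr0, add0r) block_mxEdl.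
rewrite mul_scalar_mx scalerN scaleNr opprK -scalemxAl mxE; congr (_ * _).
rewrite raised_gradientE -[in RHS](trmxK (invmx _)) -trmx_mul [RHS]mxE.
by [].
Qed.

Lemma raise_ss X i j : W X -> raise G F X (s i) (s j) = 0.
Proof.
move=> WX; rewrite /raise (invmx_static_metric omega g_unit WX) /electric_field.
rewrite tr_block_mx !mulmx_block !trmx0 !(mulmx0, mul0mx, addr0, add0r) block_mxEul.
by rewrite mxE.
Qed.

Lemma raise_tt X : W X -> raise G F X t t = 0.
Proof.
move=> WX; rewrite /raise (invmx_static_metric omega g_unit WX) /electric_field.
rewrite tr_block_mx !mulmx_block !trmx0 !(mulmx0, mul0mx, addr0, add0r) block_mxEdr.
by rewrite mxE.
Qed.

Lemma field_invariant X : W X ->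
  \sum_a \sum_b F X a b * raise G F X a b =
  - (2 * ((N (lsubmx X))^-1 * q (lsubmx X))).
Proof.
move=> WX; rewrite sum_spacetime.
have e1 i : \sum_b F X (s i) b * raise G F X (s i) b =
    - ((N (lsubmx X))^-1 * (partial i phi (lsubmx X) * v i (lsubmx X))).
  rewrite sum_spacetime big1 => [|j _]; last by rewrite raise_ss // mulr0.
  rewrite add0r raise_st // /electric_field block_mxEur !mxE.
  by rewrite mulrN mulrCA.
have e2 : \sum_b F X t b * raise G F X t b =
    - ((N (lsubmx X))^-1 * q (lsubmx X)).
  rewrite sum_spacetime raise_tt // mulr0 addr0 field_strength2E mulr_sumr -sumrN.
  apply: eq_bigr => j _; rewrite raise_ts // /electric_field block_mxEdl !mxE.
  by rewrite mulNr mulrCA.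
rewrite e2; under eq_bigr => i _ do rewrite e1.
rewrite sumrN -mulr_sumr -field_strength2E.
move: (_^-1 * _) => z; lra.
Qed.

Lemma em_tensor_static X : W X -> em_tensor kappa G F X =
  (2 / kappa) *: block_mx
    (- (N (lsubmx X))^-1 *: ((grad phi (lsubmx X))^T *m grad phi (lsubmx X))
      + (2^-1 * ((N (lsubmx X))^-1 * q (lsubmx X))) *: g (lsubmx X)) 0 0
    (2^-1 * q (lsubmx X))%:M.
Proof.
move=> WX; rewrite /em_tensor field_invariant //; congr (_ *: _).
rewrite (invmx_static_metric omega g_unit WX) /electric_field /static_metric tr_block_mx.
rewrite !mulmx_block !trmx0 !(mulmx0, mul0mx, addr0, add0r).
rewrite scale_block_mx opp_block_mx add_block_mx !scaler0 !oppr0 !addr0 trmxK.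
congr (block_mx _ _ _ _).
  rewrite mul_mx_scalar -scalemxAl; congr (_ + _); rewrite -scaleNr.
  by congr (_ *: _); move: ((N _)^-1 * _) => z; lra.
rewrite -mulmxA !mulNmx mulmxA linearN /= mulmxN opprK scale_scalar_mx.
rewrite [X in X - _]mx11_scalar -/(q _) -raddfB /=; congr (_%:M).
have := lapse_neq0 omega (lsubmx X).
move: (N _) (q _) => n z n0.
by field.
Qed.

Lemma fluid_tensor_static X P r : W X ->
  fluid_tensor G (velocity omega X) P r X =
  block_mx (P *: g (lsubmx X)) 0 0 (r * N (lsubmx X))%:M.
Proof.
move=> WX; rewrite /fluid_tensor /velocity /static_metric.
rewrite mul_row_block !(mulmx0, mul0mx, addr0, add0r).
rewrite -scalar_mxM tr_row_mx trmx0 tr_scalar_mx mul_col_row !(mulmx0, mul0mx).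
rewrite -scalar_mxM scalar_mx_block scale_block_mx !scaler0 add_block_mx !add0r.
rewrite scale_scalar_mx -raddfD /= mulmx_block !(mulmx0, mul0mx, addr0, add0r).
rewrite mul_mx_scalar -scalar_mxM; congr (block_mx _ _ _ _%:M).
(* The normalisation V_mu V^mu = -1, up to sign. *)
have : expR (- omega (lsubmx X) / 2) * (expR (- omega (lsubmx X) / 2) * N (lsubmx X)) = 1.
  rewrite -!expRD -[RHS]expR0; congr expR.
  by field.
move: (expR (- _ / 2)) (N _) => w n h.
have -> : w * (w * - n) = -1 by rewrite mulrN mulrN h.
by ring.
Qed.

(** The spatial block of - kappa (M + E) with its first index raised. *)
Let spatial_einstein x : 'M[R]_3 := - (kappa * p x + (N x)^-1 * q x)%:M +
   (2 * (N x)^-1) *: (invmx (g x) *m (grad phi x)^T *m grad phi x).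

Lemma einstein_static X : W X -> einstein G X =
  - kappa *: (block_mx (p (lsubmx X) *: g (lsubmx X)) 0 0 (rho (lsubmx X) * N (lsubmx X))%:M
  + (2 / kappa) *: block_mx
    (- (N (lsubmx X))^-1 *: ((grad phi (lsubmx X))^T *m grad phi (lsubmx X))
      + (2^-1 * ((N (lsubmx X))^-1 * q (lsubmx X))) *: g (lsubmx X)) 0 0
    (2^-1 * q (lsubmx X))%:M).
Proof.
move=> WX; have [-> _] := field_eqs WX.
by rewrite fluid_tensor_static // em_tensor_static.
Qed.

Lemma mixed_einstein_static X : W X -> mixed_einstein G X =
  block_mx (spatial_einstein (lsubmx X)) 0 0
    (kappa * rho (lsubmx X) + (N (lsubmx X))^-1 * q (lsubmx X))%:M.
Proof.
move=> WX; rewrite /mixed_einstein einstein_static // (invmx_static_metric omega g_unit WX).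
have k0 : kappa != 0 by rewrite gt_eqF.
have n0 := lapse_neq0 omega (lsubmx X).
rewrite !(scale_block_mx, add_block_mx) mulmx_block.
rewrite !(scaler0, mulmx0, mul0mx, addr0, add0r).
congr (block_mx _ _ _ _).
  rewrite -scalemxAr mulmxDr -!scalemxAr mulmxDr -!scalemxAr mulVmx ?g_unit //.
  rewrite mulmxA /spatial_einstein !scalerDr !scalerA !scalemx1.
  move: (invmx _ *m _ *m _) => M; move: (q _) (p _) n0; move: (N _) => n z P n0.
  apply/matrixP => i j; rewrite !mxE; case: eqP => _;
    rewrite ?mulr1n ?mulr0n; field; by rewrite ?k0 ?n0.
rewrite !scale_scalar_mx -!raddfD /= scale_scalar_mx -scalar_mxM; congr (_%:M).
move: n0 (q _) (rho _); move: (N _) => n n0 z r.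
by field; rewrite ?k0 ?n0.
Qed.


Let oW := open_cylinder (m := 1) oU.
(** [w] is F^{4k} (see [raise_ts]) and [S] is e^(-omega) |d phi|^2; the electric field enters
    Maxwell's equation and the stresses through them. *)
Let w k x := (N x)^-1 * v k x.
Let S x := (N x)^-1 * q x.

Let at_time0 (x : 'rV[R]_3) : 'rV[R]_(3 + 1) := row_mx x 0.
Let at_time0K x : lsubmx (at_time0 x) = x.
Proof. exact: row_mxKl. Qed.
Let at_time0P x : U x -> W (at_time0 x).
Proof. by rewrite /cylinder /= at_time0K. Qed.

Let u_C1 : Ck 1 U (fun x => (N x)^-1).
Proof.
apply: (Ck_inv oU (fun x _ => lapse_neq0 omega x)).
exact: (Ck_le oU (isT : (1 <= 3)%N) (lapse_C3 oU omega_C3)).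
Qed.

Let a_C1 i : Ck 1 U (partial i phi).
Proof. exact: (phi_C2 i).2. Qed.

Let H_C1 : Ck_matrix 1 U (fun x => invmx (g x)).
Proof.
by move=> i j; exact: (Ck_le oU (isT : (1 <= 3)%N) (invmx_metric_C3 oU g_C3 g_unit i j)).
Qed.

Let v_C1 k : Ck 1 U (v k).
Proof.
exact: (Ck_sum (index_enum 'I_3) (P := xpredT) oU
  (fun d _ => Ck_mul oU (H_C1 k d) (a_C1 d))).
Qed.

Let w_C1 k : Ck 1 U (w k).
Proof. exact: (Ck_mul oU u_C1 (v_C1 k)). Qed.

Lemma field_strength2_C1 : Ck 1 U q.
Proof.
apply: (eq_Ck oU (fun x _ => esym (field_strength2E x))).
exact: (Ck_sum (index_enum 'I_3) (P := xpredT) oU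
  (fun d _ => Ck_mul oU (a_C1 d) (v_C1 d))).
Qed.

Let S_C1 : Ck 1 U S.
Proof. exact: (Ck_mul oU u_C1 field_strength2_C1). Qed.

Let spatial_einsteinE x j i : spatial_einstein x j i =
  2 * (w j x * partial i phi x) - (kappa * p x + S x) *+ (j == i).
Proof.
rewrite /spatial_einstein mxE [X in X + _]mxE [X in _ + X]mxE [(_ *m _ *m _) j i]mxE big_ord1.
rewrite -raised_gradientE [X in _ * (_ * X)]mxE [X in - X]mxE addrC -/(S x) /w.
by move: (_ *+ _) => z; rewrite !mulrA.
Qed.

Let mixed_ss X j i : W X -> mixed_einstein G X (s j) (s i) = spatial_einstein (lsubmx X) j i.
Proof. by move=> WX; rewrite mixed_einstein_static // block_mxEul. Qed.
Let mixed_st X j : W X -> mixed_einstein G X (s j) t = 0.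
Proof. by move=> WX; rewrite mixed_einstein_static // block_mxEur mxE. Qed.
Let mixed_ts X i : W X -> mixed_einstein G X t (s i) = 0.
Proof. by move=> WX; rewrite mixed_einstein_static // block_mxEdl mxE. Qed.
Let mixed_tt X : W X ->
  mixed_einstein G X t t = kappa * rho (lsubmx X) + S (lsubmx X).
Proof. by move=> WX; rewrite mixed_einstein_static // block_mxEdr mxE. Qed.

(* The pressure inherits its differentiability from the Einstein tensor. *)
Lemma pressure_derivable i x : U x -> derivable p x (delta_mx 0 i).
Proof.
move=> Ux; pose X := at_time0 x; have WX : W X by exact: at_time0P.
have gW := static_metric_C3 oU g_C3 omega_C3.
have E1 := mixed_einstein_C1 oW gW (@static_metric_sym _ _ _ omega g_sym)
  (static_metric_unit omega g_unit) (s ord0) (s ord0).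
(* A diagonal spatial entry of the mixed Einstein tensor is [B] - kappa p; solving for p exhibits it
   as a combination of C^1 functions. *)
pose B y := 2 * (w ord0 y * partial ord0 phi y) - S y.
have cB : Ck 1 U B.
  exact: (Ck_add oU (Ck_scale 2 oU (Ck_mul oU (w_C1 ord0) (a_C1 ord0))) (Ck_opp oU S_C1)).
have cP := Ck_scale kappa^-1 oW (Ck_add oW (Ck_cylinder 1 oU cB) (Ck_opp oW E1)).
have pE Y : W Y -> kappa^-1 * (B (lsubmx Y) + - mixed_einstein G Y (s ord0) (s ord0)) =
    p (lsubmx Y).
  move=> WY; rewrite mixed_ss // spatial_einsteinE eqxx mulr1n /B.
  have k0 : kappa != 0 by rewrite gt_eqF.
  by move: (w _ _ * _) (S _) (p _) => y z P; field.
have := (eq_Ck oW pE cP (s i)).1 X WX.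
by move/derivable_space; rewrite /X at_time0K.
Qed.

(** This is d_i |d phi|^2 = 2 phi^{,j} nabla_i phi_{,j}: the inverse metric is parallel, so its
    derivative turns into Christoffel symbols. *)
Lemma partial_field_strength2 i x : U x -> partial i q x =
  2 * (\sum_j v j x * partial i (partial j phi) x)
  - 2 * (\sum_k \sum_j christoffel g k j i x * (v j x * partial k phi x)).
Proof.
move=> Ux; pose A := grad phi; pose H y := invmx (g y).
have cA : Ck_matrix 1 U A.
  by move=> a j; apply: (eq_Ck oU _ (a_C1 j)) => y _; rewrite mxE.
have dA := Ck_derivable_mx (i := i) cA Ux.
have dH := Ck_derivable_mx (i := i) H_C1 Ux.
have dAt : derivable_mx i (fun y => (A y)^T) x.
  move=> a b; have -> : (fun y => (A y)^T a b) = (fun y => A y b a).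
    by apply/funext => y; rewrite mxE.
  exact: dA.
have -> : partial i q x = dmx i (fun y => A y *m H y *m (A y)^T) x 0 0.
  by rewrite dmxE.
rewrite (dmxM (derivable_mxM dA dH) dAt) (dmxM dA dH) dmx_tr.
rewrite (invmx_metric_parallel oU g_C3 g_sym g_unit i Ux).
set D := dmx i A x; set C := christoffel_mx g i x.
have DE j : D 0 j = partial i (partial j phi) x.
  by rewrite /D dmxE; congr (partial _ _ _); apply/funext => y; rewrite mxE.
have CE k j : C k j = christoffel g k j i x by rewrite mxE.
have e1 : (D *m H x *m (A x)^T) 0 0 = \sum_j v j x * partial i (partial j phi) x.
  rewrite -mulmxA mxE; apply: eq_bigr => j _.
  by rewrite -raised_gradientE DE mulrC.
have e2 : (A x *m C *m H x *m (A x)^T) 0 0 =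
    \sum_k \sum_j christoffel g k j i x * (v j x * partial k phi x).
  rewrite -!mulmxA mxE; apply: eq_bigr => k _.
  rewrite [X in _ * X]mxE mulr_sumr; apply: eq_bigr => j _.
  by rewrite -raised_gradientE CE [X in X * _]mxE mulrC mulrA.
have tr00 (M : 'M[R]_1) : M^T 0 0 = M 0 0 by rewrite mxE.
have e3 : (A x *m H x *m D^T) 0 0 = \sum_j v j x * partial i (partial j phi) x.
  by rewrite -e1 -[RHS]tr00 !trmx_mul trmxK H_sym // mulmxA.
have e4 : (A x *m H x *m C^T *m (A x)^T) 0 0 =
    \sum_k \sum_j christoffel g k j i x * (v j x * partial k phi x).
  by rewrite -e2 -[RHS]tr00 !trmx_mul trmxK H_sym // !mulmxA.
rewrite mulmxBr mulmxN !mulmxDl !mulNmx !mulmxA.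
rewrite -/(H x).
have addE (M M' : 'M[R]_1) : (M + M') 0 0 = M 0 0 + M' 0 0 by rewrite mxE.
have oppE (M : 'M[R]_1) : (- M) 0 0 = - M 0 0 by rewrite mxE.
rewrite !(addE, oppE) e1 e2 e3 e4.
move: (\sum_j _) (\sum_k _) => y z; lra.
Qed.

Let gW := static_metric_C3 oU g_C3 omega_C3.
Let symW := @static_metric_sym _ _ _ omega g_sym.
Let unitW := static_metric_unit omega g_unit.

(** The component mu = 4. The term Gamma^4_{nu b} F^{b nu} vanishes, Gamma being symmetric and F
    antisymmetric; the other connection term is a trace, which gives [volume_gradient]. *)
Lemma maxwell_static x : U x ->
  \sum_k partial k (w k) x + \sum_k volume_gradient g omega k x * w k x =
  2^-1 * kappa * sigma x * expR (- omega x / 2).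
Proof.
move=> Ux; pose X := at_time0 x; have WX : W X by exact: at_time0P.
have lX : lsubmx X = x by exact: at_time0K.
have [_ /(_ t)] := field_eqs WX.
have -> : velocity omega X 0 t = expR (- omega x / 2).
  by rewrite /velocity row_mxEr mxE eqxx mulr1n lX.
rewrite lX => <-.
rewrite /divergence big_split /=; congr (_ + _).
  rewrite sum_spacetime.
  have -> : partial t (fun y => raise G F y t t) X = 0.
    by rewrite (eq_partial _ oW raise_tt WX) partial_cst.
  rewrite addr0; apply: eq_bigr => k _.
  rewrite (eq_partial _ oW (fun y => @raise_ts y k) WX).
  by rewrite (partial_space (w k)) lX.
have z1 : \sum_nu \sum_b christoffel G t nu b X * raise G F X b nu = 0.
  rewrite sum_spacetime.
  rewrite [X in _ + X]sum_spacetime raise_tt // mulr0 addr0 -big_split big1 //= => j _.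
  rewrite sum_spacetime big1 => [|i _]; last by rewrite raise_ss // mulr0.
  rewrite (christoffel_tst oU g_unit omega_C3 _ WX) (christoffel_tts oU g_unit omega_C3 _ WX).
  rewrite raise_st // raise_ts //.
  by rewrite add0r mulrN subrr.
have z2 : \sum_nu \sum_b christoffel G nu nu b X * raise G F X t b =
    \sum_k volume_gradient g omega k x * w k x.
  rewrite exchange_big sum_spacetime /=.
  rewrite [X in _ + X]big1 ?addr0 => [|c _]; last by rewrite raise_tt // mulr0.
  apply: eq_bigr => k _; rewrite -mulr_suml raise_ts // lX; congr (_ * _).
  rewrite -[in RHS]lX -(christoffel_trace oU g_unit omega_C3 _ WX); apply: eq_bigr => c _.
  exact: (christoffel_sym oW symW _ _ _ WX).
under [RHS]eq_bigr => c _ do rewrite big_split.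
by rewrite [RHS]big_split /= z1 z2 add0r.
Qed.


(** kappa times the conservation law for nu = i. In the expanded divergence of the mixed Einstein
    tensor, the gradient of [S] cancels the Hessian of phi and the remaining terms in [S]; the
    divergence of [w] survives, and Maxwell's equation turns it into the electric force. *)
Lemma pressure_gradient i x : U x ->
  kappa * partial i p x
    + 2^-1 * kappa * ((N x)^-1 * partial i N x) * (p x + rho x) =
  kappa * (sigma x * expR (- omega x / 2)) * partial i phi x.
Proof.
move=> Ux; pose X := at_time0 x; have WX : W X by exact: at_time0P.
have lX : lsubmx X = x by exact: at_time0K.
have := einstein_conserved oW gW symW unitW (s i) WX.
have dp j : derivable p x (delta_mx 0 j) by exact: (pressure_derivable Ux).
have dS j := (S_C1 j).1 x Ux.
have dw k j := (w_C1 k j).1 x Ux.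
have da k j := (a_C1 k j).1 x Ux.
pose P y := kappa * p y + S y.
have dP j : derivable P x (delta_mx 0 j).
  exact: (derivableD (derivableZ (dp j)) (dS j)).
have PE j : partial j P x = kappa * partial j p x + partial j S x.
  by rewrite (partialD (derivableZ (dp j)) (dS j)) (partialZ _ (dp j)).
have dT j : partial j (fun y => spatial_einstein y j i) x =
    2 * (partial j (w j) x * partial i phi x + w j x * partial j (partial i phi) x)
    - (partial i P x) *+ (j == i).
  have d1 := derivableM (dw j j) (da i j).
  have d2 := derivableZ (k := 2) d1.
  have e2 : partial j (fun y => 2 * (w j y * partial i phi y)) x =
    2 * (partial j (w j) x * partial i phi x + w j x * partial j (partial i phi) x).
    by rewrite (partialZ _ d1) (partialM (dw j j) (da i j)).
  case: (eqVneq j i) => [ji|/negPf ji].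
    have -> : (fun y => spatial_einstein y j i) = (fun y => 2 * (w j y * partial i phi y) - P y).
      by apply/funext => y; rewrite spatial_einsteinE ji eqxx mulr1n.
    by rewrite (partialB d2 (dP j)) e2 mulr1n ji.
  have -> : (fun y => spatial_einstein y j i) = (fun y => 2 * (w j y * partial i phi y)).
    by apply/funext => y; rewrite spatial_einsteinE ji mulr0n subr0.
  by rewrite e2 mulr0n subr0.
have sum_delta (Z : 'I_3 -> R) c k : \sum_e Z e * (c *+ (e == k)) = c * Z k.
  rewrite (bigD1 k) //= eqxx mulr1n [X in _ + X]big1 ?addr0 1?mulrC //.
  by move=> e /negPf ->; rewrite mulr0n mulr0.
pose a := partial i phi x.
have -> : \sum_b dmx b (mixed_einstein G) X b (s i) =
    2 * ((\sum_k partial k (w k) x) * a)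
    + 2 * (\sum_k w k x * partial i (partial k phi) x) - partial i P x.
  rewrite sum_spacetime.
  have -> : dmx t (mixed_einstein G) X t (s i) = 0.
    rewrite dmxE (eq_partial _ oW (fun y => @mixed_ts y i) WX).
    exact: partial_cst.
  have e j : dmx (s j) (mixed_einstein G) X (s j) (s i) =
      2 * (partial j (w j) x * a) + 2 * (w j x * partial i (partial j phi) x)
      - 1 * (partial i P x *+ (j == i)).
    rewrite dmxE (eq_partial _ oW (fun y => @mixed_ss y j i) WX).
    rewrite (partial_space (fun y => spatial_einstein y j i)) lX dT mulrDr mul1r.
    (* Exchanging the derivatives of phi produces the terms that occur in the gradient of |d
       phi|^2. *)
    by rewrite (schwarz j i oU phi_C2 Ux).
  under eq_bigr => j _ do rewrite e.
  rewrite addr0 sumrB (sum_delta (fun=> 1)) mulr1 big_split /=.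
  by rewrite mulr_suml !mulr_sumr.
have -> : \sum_e (\sum_b christoffel G b e b X) * mixed_einstein G X e (s i) =
    2 * ((\sum_k volume_gradient g omega k x * w k x) * a)
    - P x * volume_gradient g omega i x.
  rewrite sum_spacetime mixed_ts // mulr0 addr0
    -(sum_delta (fun j => volume_gradient g omega j x) (P x) i).
  rewrite mulr_suml mulr_sumr -sumrB.
  apply: eq_bigr => j _; rewrite (christoffel_trace oU g_unit omega_C3 _ WX) lX.
  rewrite mixed_ss // lX spatial_einsteinE -/a -/(P x) mulrBr; congr (_ - _).
  by rewrite mulrCA !mulrA.
have -> : \sum_c \sum_e christoffel G c e (s i) X * mixed_einstein G X e c =
    2 * (\sum_k \sum_j christoffel g k j i x * (w j x * partial k phi x))
    - P x * \sum_k christoffel g k i k x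
    + 2^-1 * ((N x)^-1 * partial i N x) * (kappa * rho x + S x).
  rewrite sum_spacetime; congr (_ + _); last first.
    rewrite sum_spacetime mixed_tt // (christoffel_tts oU g_unit omega_C3 _ WX) lX.
    rewrite big1 ?add0r // => j _; by rewrite mixed_st // mulr0.
  rewrite !mulr_sumr -sumrB; apply: eq_bigr => k _.
  rewrite sum_spacetime mixed_ts // mulr0 addr0.
  have -> : christoffel g k i k x = christoffel g k k i x.
    exact: (christoffel_sym oU g_sym _ _ _ Ux).
  rewrite -(sum_delta (fun j => christoffel g k j i x) (P x) k) mulr_sumr -sumrB.
  apply: eq_bigr => j _; rewrite mixed_ss // (christoffel_sss omega g_unit _ _ _ WX) lX.
  by rewrite spatial_einsteinE -/(P x) mulrBr mulrCA.
have wS : partial i S x = - ((N x)^-1 * (N x)^-1 * partial i N x * q x)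
    + 2 * (\sum_k w k x * partial i (partial k phi) x)
    - 2 * (\sum_k \sum_j christoffel g k j i x * (w j x * partial k phi x)).
  have dN := (lapse_C3 oU omega_C3 i).1 x Ux.
  have du := (u_C1 i).1 x Ux.
  have dq := (field_strength2_C1 i).1 x Ux.
  rewrite (partialM du dq) (partialV (lapse_neq0 omega x) dN) partial_field_strength2 //.
  have -> : \sum_k w k x * partial i (partial k phi) x =
      (N x)^-1 * \sum_k v k x * partial i (partial k phi) x.
    by rewrite mulr_sumr; apply: eq_bigr => k _; rewrite /w mulrA.
  have -> : \sum_k \sum_j christoffel g k j i x * (w j x * partial k phi x) =
      (N x)^-1 * \sum_k \sum_j christoffel g k j i x * (v j x * partial k phi x).
    rewrite mulr_sumr; apply: eq_bigr => k _; rewrite mulr_sumr; apply: eq_bigr => j _.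
    by rewrite /w [RHS]mulrCA; congr (_ * _); rewrite mulrA.
  move: (\sum_k _ * _) (\sum_k \sum_j _) (partial i N x) ((N x)^-1) => y z n u.
  by ring.
have := maxwell_static Ux; move: wS; rewrite PE /P.
set J := \sum_k partial k (w k) x; set K := \sum_k volume_gradient g omega k x * w k x.
set Y := \sum_k w k x * _; set Z := \sum_k \sum_j _.
rewrite /volume_gradient /S; set tau := \sum_k christoffel _ _ _ _ _.
move: J K Y Z tau (partial i p x) (partial i _ x) (partial i N x) ((N x)^-1).
move=> J K Y Z tau pi Si n u.
rewrite -/a; move: a (q x) (p x) (rho x) (sigma x) (expR _) => a qx px rx sx e -> mx h.
have JE : J = 2^-1 * kappa * sx * e - K by rewrite -mx addrK.
by apply/eqP; rewrite -subr_eq0 -oppr_eq0 -h JE; apply/eqP; rewrite opprB; field.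
Qed.

(** Trace reversal. In dimension 4 the trace of the mixed Einstein tensor is - R, and the
    electromagnetic part contributes nothing to it, so R = kappa (3 p - rho); inserting this in
    G^4_4 isolates R_44. *)
Lemma lapse_equation x : U x ->
  ricci G (at_time0 x) t t =
  - (N x * (2^-1 * kappa * (3 * p x + rho x) + S x)).
Proof.
move=> Ux; pose X := at_time0 x; have WX : W X by exact: at_time0P.
have lX : lsubmx X = x by exact: at_time0K.
have tr := mixed_einstein_trace symW unitW WX.
have := mixed_einstein_entry symW unitW t t WX.
rewrite eqxx mulr1n mixed_tt // lX.
have -> : (invmx (G X) *m ricci G X) t t = - ((N x)^-1 * ricci G X t t).
  rewrite mxE sum_spacetime big1 => [|k _]; last first.
    by rewrite (invmx_static_ts omega g_unit _ WX) mul0r.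
  by rewrite add0r (invmx_static_tt omega g_unit WX) lX mulNr.
move: tr; rewrite sum_spacetime mixed_tt // lX.
have -> : \sum_k mixed_einstein G X (s k) (s k) = 2 * S x - 3 * (kappa * p x + S x).
  under eq_bigr => k _ do rewrite mixed_ss // lX spatial_einsteinE eqxx mulr1n.
  have SE : \sum_k w k x * partial k phi x = S x.
    rewrite /S field_strength2E mulr_sumr; apply: eq_bigr => k _.
    by rewrite /w -mulrA [X in _ * X]mulrC.
  rewrite sumrB sumr_const card_ord -mulr_sumr SE.
  by rewrite -[_ *+ 3]mulr_natl.
have n0 := lapse_neq0 omega x.
move: n0 (scalar_curvature _ _) (ricci _ _ _ _) (S x); move: (N x) => n n0 r c y.
move=> tr e; have er : r = 3 * kappa * p x - kappa * rho x by lra.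
have ec : c = - (n * (kappa * rho x + y + 2^-1 * r)).
  by rewrite e; field.
by rewrite ec er; field.
Qed.

(** Read off from the field equations: the matter enters through the pressure alone, and the rest
    depends only on g, omega and d phi, whose limits at the boundary are common to both sides. *)
Lemma normal_einstein_static eta x : U x ->
  normal_einstein g omega eta x =
  - (kappa * p x * (eta *m g x *m eta^T) 0 0)
  + (N x)^-1 * (2 * (eta *m (grad phi x)^T) 0 0 ^+ 2
                - q x * (eta *m g x *m eta^T) 0 0).
Proof.
move=> Ux; rewrite /normal_einstein -/(at_time0 x).
rewrite (einstein_static (at_time0P Ux)) at_time0K.
rewrite !(scale_block_mx, add_block_mx) block_mxKul.
have k0 : kappa != 0 by rewrite gt_eqF.
set A := grad phi x; set u := (N x)^-1.
have e : (eta *m (A^T *m A) *m eta^T) 0 0 = (eta *m A^T) 0 0 ^+ 2.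
  rewrite mulmxA -mulmxA mxE big_ord1 expr2; congr (_ * _).
  have <- : (A *m eta^T)^T 0 0 = (A *m eta^T) 0 0 by rewrite mxE.
  by rewrite trmx_mul trmxK.
have addE (M M' : 'M[R]_1) : (M + M') 0 0 = M 0 0 + M' 0 0 by rewrite mxE.
have sclE c (M : 'M[R]_1) : (c *: M) 0 0 = c * M 0 0 by rewrite mxE.
rewrite -scalemxAr -scalemxAl mulmxDr mulmxDl -!scalemxAr -!scalemxAl.
rewrite !mulmxDr !mulmxDl -!scalemxAr -!scalemxAl !(sclE, addE) e.
move: (_ ^+ 2) ((eta *m g x *m _) 0 0) (q x) (p x) => y z w' P.
by field.
Qed.

(** * Fluids of Majumdar type *)

Section majumdar.
Variable C0 : R.
Hypothesis majumdar : forall x, U x -> N x = (C0 + phi x) ^+ 2.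

Let psi y := C0 + phi y.

Let psi_neq0 x : U x -> psi x != 0.
Proof.
move=> Ux; apply/eqP => z; have := lapse_neq0 omega x.
by rewrite majumdar // -/(psi x) z expr0n eqxx.
Qed.

Let derivable_psi i x : U x -> derivable psi x (delta_mx 0 i).
Proof. by move=> Ux; exact: (derivableD (derivable_cst _ _ _) ((phi_C2 i).1 x Ux)). Qed.

Let partial_psi i x : U x -> partial i psi x = partial i phi x.
Proof.
move=> Ux; rewrite (partialD (derivable_cst C0 _ _) ((phi_C2 i).1 x Ux)).
by rewrite partial_cst add0r.
Qed.

Let partial_lapse i x : U x -> partial i N x = 2 * psi x * partial i phi x.
Proof.
move=> Ux; rewrite (eq_partial (g := fun y => psi y * psi y) i oU _ Ux) => [|y Uy].
  have d := derivable_psi (i := i) Ux.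
  by rewrite (partialM d d) (partial_psi _ Ux) [_ * psi x]mulrC -mulrA mulr_natl.
by rewrite majumdar.
Qed.

(** N = psi^2 gives N^{,k} = 2 psi phi^{,k}, and phi^{,k} = psi^2 w^k. Expressing the result through
    [w] lets Maxwell's equation supply the divergence. *)
Let raised_gradient_lapse k x : U x ->
  raised_gradient g N k x = 2 * (psi x * psi x * psi x * w k x).
Proof.
move=> Ux; rewrite /w majumdar // -/(psi x).
have -> : raised_gradient g N k x = 2 * psi x * v k x.
  rewrite /raised_gradient mulr_sumr; apply: eq_bigr => d _.
  by rewrite (partial_lapse _ Ux) mulrCA.
have := psi_neq0 Ux; move: (psi x) (v k x) => y z y0.
by field.
Qed.

(* Maxwell's equation and the tt component of Einstein's equations both compute
   the Laplacian of phi; comparing them gives sigma = +- (3 p + rho). *)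
Lemma majumdar_charge x : U x ->
  psi x * (sigma x * expR (- omega x / 2)) = 3 * p x + rho x.
Proof.
move=> Ux; pose X := at_time0 x; have WX : W X by exact: at_time0P.
have lX : lsubmx X = x by exact: at_time0K.
have := lapse_equation Ux; rewrite (ricci_tt oU g_C3 g_unit omega_C3 WX) lX.
have dpsi k := derivable_psi (i := k) Ux.
have dw k := (w_C1 k k).1 x Ux.
have dn k : partial k (raised_gradient g N k) x =
    2 * (3 * (psi x * psi x) * (w k x * partial k phi x)
         + psi x * psi x * psi x * partial k (w k) x).
  rewrite (eq_partial k oU (@raised_gradient_lapse k) Ux).
  have d2 := derivableM (dpsi k) (dpsi k); have d3 := derivableM d2 (dpsi k).
  have d4 := derivableM d3 (dw k).
  rewrite (partialZ 2 d4) (partialM d3 (dw k)) (partialM d2 (dpsi k)).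
  rewrite (partialM (dpsi k) (dpsi k)) (partial_psi _ Ux).
  rewrite -[(psi * psi * psi) x]/(psi x * psi x * psi x) -[(psi * psi) x]/(psi x * psi x).
  move: (psi x) (w k x) (partial k phi x) (partial k (w k) x) => y z a b.
  by ring.
have SE : S x = \sum_k w k x * partial k phi x.
  rewrite /S field_strength2E mulr_sumr; apply: eq_bigr => k _.
  by rewrite /w -mulrA [X in _ * X]mulrC.
have -> : \sum_k partial k (raised_gradient g N k) x =
    2 * (3 * (psi x * psi x) * S x
         + psi x * psi x * psi x * \sum_k partial k (w k) x).
  by rewrite SE !mulr_sumr -big_split mulr_sumr; apply: eq_bigr => k _; rewrite dn.
have psi0 := psi_neq0 Ux.
have -> : \sum_k (N x)^-1 * partial k N x * raised_gradient g N k x =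
    4 * (psi x * psi x) * S x.
  rewrite SE mulr_sumr; apply: eq_bigr => k _.
  rewrite (partial_lapse _ Ux) (raised_gradient_lapse _ Ux) majumdar // -/(psi x).
  move: psi0; move: (psi x) (w k x) (partial k phi x) => y z a y0.
  by field.
have -> : \sum_k raised_gradient g N k x * volume_gradient g omega k x =
    2 * (psi x * psi x * psi x) * \sum_k volume_gradient g omega k x * w k x.
  rewrite mulr_sumr; apply: eq_bigr => k _.
  rewrite (raised_gradient_lapse _ Ux).
  by move: (volume_gradient _ _ _ _) (w k x) (psi x) => y z a; ring.
rewrite majumdar // -/(psi x).
have mx := maxwell_static Ux.
have k0 : kappa != 0 by rewrite gt_eqF.
move: mx psi0 (p x) (rho x).
move: (\sum_k partial k (w k) x) (\sum_k _ * w k x) (S x) (psi x) (sigma x) (expR _).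
move=> J K s0 y sx e mx y0 P r h.
have JE : J = 2^-1 * kappa * sx * e - K by rewrite -mx addrK.
(* The terms in [S] cancel, -3 + 2 on the left against -1 on the right, and Maxwell's equation
   replaces [J] + [K]. What is left is the claim multiplied by kappa psi^2. *)
have {}h : y * y * (kappa * (y * (sx * e))) = y * y * (kappa * (3 * P + r)).
  move/eqP: h; rewrite -subr_eq0 => /eqP h.
  by apply/eqP; rewrite -subr_eq0 -(mulr0 (-2)) -h JE; apply/eqP; field.
by move: h => /(mulfI (mulf_neq0 y0 y0)) /(mulfI k0).
Qed.

Lemma majumdar_pressure i x : U x ->
  derivable (fun y => p y * (N y)^-1) x (delta_mx 0 i) /\
  partial i (fun y => p y * (N y)^-1) x = 0.
Proof.
move=> Ux; have dp : derivable p x (delta_mx 0 i) by exact: (pressure_derivable Ux).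
have du := (u_C1 i).1 x Ux.
have dN := (lapse_C3 oU omega_C3 i).1 x Ux.
split; first exact: (derivableM dp du).
rewrite (partialM dp du) (partialV (lapse_neq0 omega x) dN).
have := pressure_gradient i Ux; have := majumdar_charge Ux.
rewrite (partial_lapse _ Ux) majumdar // -/(psi x).
have k0 : kappa != 0 by rewrite gt_eqF.
move: (psi_neq0 Ux) (sigma x * _) (partial i p x) (partial i phi x) (p x) (rho x).
move: (psi x) => y y0 m dP a P r ch pg.
(* The density drops out: (3 p + rho) - (p + rho) = 2 p. *)
have e : y * dP = 2 * P * a.
  apply: (mulfI k0).
  have -> : kappa * (y * dP) =
      y * (kappa * m * a) - y * (2^-1 * kappa * ((y ^+ 2)^-1 * (2 * y * a)) * (P + r)).
    by rewrite -pg; ring.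
  have -> : y * (kappa * m * a) = kappa * (y * m) * a by ring.
  by rewrite ch; field.
have -> : dP = 2 * P * a / y by rewrite -e mulrC mulKf.
by field.
Qed.

End majumdar.

End charged_fluid.

(** * The region occupied by the fluid and its boundary *)

Lemma symmetric_posdef_unitmx (R : realType) n (M : 'M[R]_n) :
  symmetric_posdef M -> M \in unitmx.
Proof.
move=> [_ pos]; rewrite -row_free_unit -kermx_eq0; apply/negPn/negP => /rowV0Pn[v].
by move=> /sub_kermxP vM /pos; rewrite vM mul0mx mxE ltxx.
Qed.

Section charts.
Variables (R : realType) (S : topologicalType) (c : chart R S).
Local Notation map := (chart_map c).
Local Notation inv := (chart_inv c).

Lemma chart_near s (P : set 'rV[R]_3) : chart_dom c s -> nbhs (map s) P ->
  \forall q \near s, P (map q).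
Proof.
move=> ds nP; have := chart_map_continuous (c := c).
rewrite continuous_open_subspace; last exact: chart_dom_open.
by move=> /(_ s (mem_set ds)); exact.
Qed.

Lemma chart_inv_near s (W : set S) : chart_dom c s -> nbhs s W ->
  \forall y \near map s, W (inv y).
Proof.
move=> ds nW; have := chart_inv_continuous (c := c).
rewrite continuous_open_subspace; last exact: chart_img_open.
move=> /(_ (map s)); have -> : map s \in map @` chart_dom c by apply: mem_set; exists s.
by move=> /(_ isT); apply; rewrite chart_mapK.
Qed.

Lemma chart_image_open (W : set S) : open W -> open (map @` (chart_dom c `&` W)).
Proof.
move=> oW; rewrite openE => y [s [ds Ws] <-]; rewrite /interior.
have n1 := chart_inv_near ds (open_nbhs_nbhs (conj oW Ws)).
have n2 : \forall y \near map s, (map @` chart_dom c) y.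
  by apply: open_nbhs_nbhs; split; [exact: chart_img_open|exists s].
apply: filterS2 n1 n2 => y1 W1 [s' ds' e1]; move: W1; rewrite -{}e1 chart_mapK // => Ws'.
by exists s'.
Qed.

End charts.

(** A level set of f in D and its complement in D are both open, so a nonempty level set is all of
    D. *)
Lemma connected_locally_constant (T : topologicalType) (V : Type) (D : set T)
    (f : T -> V) : open D -> connected D ->
  (forall s, D s -> \forall s' \near s, f s' = f s) ->
  forall s s', D s -> D s' -> f s = f s'.
Proof.
move=> oD cD lc s s' Ds Ds'.
have oE (P : V -> Prop) : open [set r | D r /\ P (f r)].
  rewrite openE => r [Dr Pr]; rewrite /interior.
  apply: filterS2 (lc r Dr) (open_nbhs_nbhs (conj oD Dr)) => r' e Dr'.
  by split => //; rewrite e.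
have e : [set r | D r /\ f r = f s] = D.
  apply: cD.
  - by exists s.
  - exists [set r | D r /\ f r = f s]; first exact: (oE (fun z => z = f s)).
    by apply/seteqP; split=> [r [Dr e]|r [_ [Dr e]]]; split.
  - exists (~` [set r | D r /\ f r <> f s]).
      by apply: open_closedC; exact: (oE (fun z => z <> f s)).
    apply/seteqP; split=> [r [Dr e]|r [Dr ne]]; split=> //; first by case.
    by apply: contrapT => ne'; apply: ne.
have : [set r | D r /\ f r = f s] s' by rewrite e.
by case=> _ ->.
Qed.

(* Otherwise the boundary point would be a local maximum of the function u. *)
Lemma positive_nearby (R : realType) n (U V : set 'rV[R]_n) (u : 'rV[R]_n -> R) x :
  open U -> U x -> Ck 1 U u -> u x = 0 -> grad u x != 0 -> nbhs x V ->
  exists2 y, V y & 0 < u y.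
Proof.
move=> oU Ux cu u0 du nV; apply: contrapT => nex.
have [r /= r0 hr] := (nbhs_ballP _ _).1 (filterI nV (open_nbhs_nbhs (conj oU Ux))).
move/eqP: du; apply; apply/rowP => i; rewrite !mxE.
have bx h : h \in `]-r, r[ -> ball x r (h *: delta_mx 0 i + x).
  rewrite in_itv /= => /andP[h1 h2]; split => // a j; rewrite (ord1 a) /ball /= distrC !mxE eqxx /=.
  rewrite addrK; case: (j == i); rewrite ?mulr1 ?mulr0 ?normr0 //.
  by rewrite ltr_norml h1.
have d0 : 0 \in `]-r, r[ by rewrite in_itv /= oppr_lt0 r0.
have dF h : h \in `]-r, r[ -> is_derive h 1 (fun h : R => u (h *: delta_mx 0 i + x))
    ('D_(delta_mx 0 i) u (h *: delta_mx 0 i + x)).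
  by move=> /bx /hr[_ Uy]; apply: is_derive_along; exact: (cu i).1.
have [] := @derive1_at_max R (fun h => u (h *: delta_mx 0 i + x)) (-r) r 0.
- by rewrite ge0_cp // ltW.
- by move=> h /dF[].
- exact: d0.
- move=> h /bx /hr[Vy _]; rewrite scale0r add0r u0 leNgt; apply/negP => uy.
  by apply: nex; exists (h *: delta_mx 0 i + x).
move=> _ e; have [_] := dF 0 d0.
by rewrite e /partial scale0r add0r => <-.
Qed.

Section fluid_body.
Variables (R : realType) (S : topologicalType) (A : set (chart R S)).
Variables (kappa : R) (g : chart R S -> 'rV[R]_3 -> 'M[R]_3).
Variables (omega phi : S -> R).
Hypothesis kappa_gt0 : 0 < kappa.
Hypothesis metric_g : riemannian_metric A g.

Local Notation om c := (omega \o chart_inv c).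
Local Notation ph c := (phi \o chart_inv c).

Section region.
Variables (p rho sigma : S -> R) (V : set S).
Hypothesis oV : open V.
Hypothesis regular : regular_field A g omega phi V.
Hypothesis eqs : field_equations A kappa g omega phi p rho sigma V.
Variable c : chart R S.
Hypothesis Ac : A c.

Let U := chart_map c @` (chart_dom c `&` V).

Let g_sym x : U x -> (g c x)^T = g c x.
Proof. by move=> [s [ds _] <-]; have [[]] := metric_g.1 c Ac s ds. Qed.

Let g_unit x : U x -> g c x \in unitmx.
Proof.
move=> [s [ds _] <-]; apply: symmetric_posdef_unitmx.
exact: (metric_g.1 c Ac s ds).1.
Qed.

Let field_eqs X : cylinder (m := 1) U X -> einstein_maxwell kappa (g c) (om c) (ph c)
  ((p \o chart_inv c) (lsubmx X)) ((rho \o chart_inv c) (lsubmx X))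
  ((sigma \o chart_inv c) (lsubmx X)) X.
Proof.
move=> [s [ds Vs] e]; have := eqs Ac ds Vs (rsubmx X 0 0).
by rewrite -mx11_scalar /= e hsubmxK -e /= chart_mapK.
Qed.

(** Stated for any open [V], because it serves on both sides of the boundary: for the fluid and,
    with zero pressure, for the exterior. *)
Lemma normal_einstein_chart eta s : chart_dom c s -> V s ->
  let x := chart_map c s in
  normal_einstein (g c) (om c) eta x =
  - (kappa * p s * (eta *m g c x *m eta^T) 0 0)
  + (expR (omega s))^-1 * (2 * (eta *m (grad (ph c) x)^T) 0 0 ^+ 2
      - field_strength2 (g c) (ph c) x * (eta *m g c x *m eta^T) 0 0).
Proof.
move=> ds Vs x; have oU := chart_image_open (c := c) oV.
have Ux : U x by exists s.
rewrite (normal_einstein_static kappa_gt0 g_unit field_eqs eta Ux) /=.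
by rewrite /x chart_mapK.
Qed.

Variable C0 : R.
Hypothesis majumdar : forall s, V s -> expR (omega s) = (C0 + phi s) ^+ 2.

Lemma majumdar_pressure_locally_constant s : chart_dom c s -> V s ->
  \forall s' \near s, p s' / expR (omega s') = p s / expR (omega s).
Proof.
move=> ds Vs; have oU := chart_image_open (c := c) oV.
have [g_C3 omega_C3 phi_C2] := regular Ac.
have maj x : U x -> expR ((om c) x) = (C0 + (ph c) x) ^+ 2.
  by move=> [r [dr Vr] <-] /=; rewrite chart_mapK // majumdar.
have H := majumdar_pressure oU kappa_gt0 g_C3 g_sym g_unit omega_C3 phi_C2 field_eqs maj.
have Ux : U (chart_map c s) by exists s.
have nU : nbhs (chart_map c s) U by exact: open_nbhs_nbhs.
have [r /= r0 hr] := (nbhs_ballP _ _).1 nU.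
have lc := @locally_constant_of_partial0 _ _ _ _ r
  (fun z bz i => (H i z (hr z bz)).1) (fun z bz i => (H i z (hr z bz)).2).
have := chart_near ds (nbhsx_ballx (chart_map c s) r r0).
apply: filterS2 (open_nbhs_nbhs (conj (chart_dom_open c) ds)) => s' ds' /lc /=.
by rewrite !chart_mapK.
Qed.

End region.



(** * One-sided limits at a boundary point *)

Section boundary_limit.
Variables (c : chart R S) (s : S) (eta : 'rV[R]_3) (l : 'I_3 -> R).
Hypothesis Ac : A c.
Hypothesis ds : chart_dom c s.
Hypothesis omega_continuous : continuous omega.

Let metric_entry_near i j :
  (fun r => g c (chart_map c r) i j) @ s --> g c (chart_map c s) i j.
Proof.
have cg := (metric_g.1 c Ac s ds).2.
have ce : {for chart_map c s, continuous (fun y => g c y i j)}.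
  exact: (continuous_comp cg (@coord_continuous _ _ _ i j _)).
by move=> P /ce; exact: chart_near.
Qed.

(** Across the boundary the metric is only known to be continuous; its inverse inherits this from
    [Ck_invmx] at class 0. *)
Let inverse_entry_near i j :
  (fun r => invmx (g c (chart_map c r)) i j) @ s --> invmx (g c (chart_map c s)) i j.
Proof.
have oU := chart_img_open (c := c).
have c0 : Ck_matrix 0 (chart_map c @` chart_dom c) (g c).
  move=> a b x [r dr <-]; have cg := (metric_g.1 c Ac r dr).2.
  exact: (continuous_comp cg (@coord_continuous _ _ _ a b _)).
have u0 x : (chart_map c @` chart_dom c) x -> g c x \in unitmx.
  move=> [r dr <-]; exact: symmetric_posdef_unitmx (metric_g.1 c Ac r dr).1.
have Us : (chart_map c @` chart_dom c) (chart_map c s) by exists s.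
have cI : Ck 0 (chart_map c @` chart_dom c) (fun y => invmx (g c y) i j).
  exact: (Ck_invmx oU u0 c0).
have ce := cI _ Us.
by move=> P /ce; exact: chart_near.
Qed.

Let cvg_sum (F : set_system S) (FF : Filter F) (f : 'I_3 -> S -> R) (z : 'I_3 -> R) :
  (forall i, f i @ F --> z i) -> (fun r => \sum_i f i r) @ F --> \sum_i z i.
Proof.
move=> fz; apply: (@cvg_big _ _ +%R) => //; exact: add_continuous.
Qed.

Lemma metric_form_cvg (F : set_system S) (FF : Filter F) : F --> s ->
  (fun r => (eta *m g c (chart_map c r) *m eta^T) 0 0) @ F -->
  (eta *m g c (chart_map c s) *m eta^T) 0 0.
Proof.
move=> Fs.
have E r : (eta *m g c (chart_map c r) *m eta^T) 0 0 =
    \sum_j (\sum_i eta 0 i * g c (chart_map c r) i j) * eta 0 j.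
  by rewrite mxE; apply: eq_bigr => j _; rewrite !mxE.
rewrite E; have -> : (fun r => (eta *m g c (chart_map c r) *m eta^T) 0 0) =
    (fun r => \sum_j (\sum_i eta 0 i * g c (chart_map c r) i j) * eta 0 j) by apply/funext.
apply: (@cvg_sum _ FF) => j; apply: cvgM; last exact: cvg_cst.
apply: (@cvg_sum _ FF) => i; apply: cvgM; first exact: cvg_cst.
by move=> P /metric_entry_near; exact: Fs.
Qed.

(** The limit is written with the limits [l] of the partial derivatives of phi, not with their
    values at [s]. Filters approaching [s] from the two sides with the same [l] therefore give the
    same number. *)
Lemma normal_field_cvg (F : set_system S) (FF : Filter F) : F --> s ->
  (forall i, (fun r => partial i (ph c) (chart_map c r)) @ F --> l i) ->
  (fun r => (expR (omega r))^-1 *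
     (2 * (eta *m (grad (ph c) (chart_map c r))^T) 0 0 ^+ 2
      - field_strength2 (g c) (ph c) (chart_map c r) *
        (eta *m g c (chart_map c r) *m eta^T) 0 0)) @ F -->
  (expR (omega s))^-1 * (2 * (\sum_i eta 0 i * l i) ^+ 2
    - (\sum_k l k * \sum_d invmx (g c (chart_map c s)) k d * l d) *
      (eta *m g c (chart_map c s) *m eta^T) 0 0).
Proof.
move=> Fs al.
have cN : (fun r => (expR (omega r))^-1) @ F --> (expR (omega s))^-1.
  apply: cvgV; first by rewrite gt_eqF // expR_gt0.
  have cl : {for s, continuous (fun r => expR (omega r))}.
    exact: (continuous_comp (@omega_continuous s) (@continuous_expR R _)).
  by move=> P /cl; exact: Fs.
have c1 : (fun r => (eta *m (grad (ph c) (chart_map c r))^T) 0 0) @ F -->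
    \sum_i eta 0 i * l i.
  have -> : (fun r => (eta *m (grad (ph c) (chart_map c r))^T) 0 0) =
     (fun r => \sum_i eta 0 i * partial i (ph c) (chart_map c r)).
    by apply/funext => r; rewrite mxE; apply: eq_bigr => i _; rewrite !mxE.
  apply: (@cvg_sum _ FF) => i; exact: (cvgM (cvg_cst _) (al i)).
have c2 : (fun r => field_strength2 (g c) (ph c) (chart_map c r)) @ F -->
    \sum_k l k * \sum_d invmx (g c (chart_map c s)) k d * l d.
  have -> : (fun r => field_strength2 (g c) (ph c) (chart_map c r)) =
      (fun r => \sum_k partial k (ph c) (chart_map c r) *
        \sum_d invmx (g c (chart_map c r)) k d * partial d (ph c) (chart_map c r)).
    by apply/funext => r; rewrite field_strength2E.
  apply: (@cvg_sum _ FF) => k; apply: cvgM; first exact: al.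
  apply: (@cvg_sum _ FF) => d; apply: cvgM; last exact: al.
  by move=> P /inverse_entry_near; exact: Fs.
have c3 := metric_form_cvg FF Fs.
apply: (cvgM cN); apply: cvgB; last exact: (cvgM c2 c3).
apply: (cvgM (cvg_cst _)); rewrite expr2.
have -> : (fun r => (eta *m (grad (ph c) (chart_map c r))^T) 0 0 ^+ 2) =
  (fun r => (eta *m (grad (ph c) (chart_map c r))^T) 0 0 *
            (eta *m (grad (ph c) (chart_map c r))^T) 0 0).
  by apply/funext => r; rewrite expr2.
exact: (cvgM c1 c1).
Qed.

End boundary_limit.

(** [unit_normal] is a multiple of the raised gradient v of u, and the number under its square root
    is v g v^T, positive because v is nonzero. *)
Lemma unit_normal_form_gt0 c s u : A c -> chart_dom c s ->
  let x := chart_map c s in let eta := unit_normal (g c) u x in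
  grad u x != 0 -> 0 < (eta *m g c x *m eta^T) 0 0.
Proof.
move=> Ac ds x eta du; have pos := (metric_g.1 c Ac s ds).1.
have un := symmetric_posdef_unitmx pos.
pose v := grad u x *m invmx (g c x).
have v0 : v != 0.
  apply/eqP => /(congr1 (fun M => M *m g c x)).
  by rewrite mulmxKV // mul0mx => /eqP; exact/negP.
have vv : (grad u x *m invmx (g c x) *m (grad u x)^T) 0 0 = (v *m g c x *m v^T) 0 0.
  rewrite /v mulmxKV // trmx_mul trmx_inv pos.1.
  by rewrite mulmxA.
apply: pos.2; rewrite /eta /unit_normal -/v scaler_eq0 negb_or v0 andbT.
by rewrite invr_eq0 vv gt_eqF // sqrtr_gt0 pos.2.
Qed.

End fluid_body.

(** Ensures that a boundary point can be approached from outside. It lies neither in D nor in the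
    exterior, so u vanishes there, and since du is nonzero u takes positive values arbitrarily close
    to it. *)
Lemma frontier_exterior (R : realType) (S : topologicalType) (c : chart R S)
    (D : set S) (s : S) (u : 'rV[R]_3 -> R) : open D -> chart_dom c s ->
  frontier D s -> separating_function c D s u -> closure (exterior D) s.
Proof.
move=> oD ds [cDs nDs] [du [U [[oU Ux] Udom cu sep]]].
have uE : u (chart_map c s) = 0.
  have [sD sE] := sep _ Ux; rewrite chart_mapK // in sD sE.
  apply/eqP; rewrite eq_le !leNgt; apply/andP; split; apply/negP.
    by move/sE; apply.
  by move/sD => Ds; apply: nDs; rewrite -(interior_id D).1 in Ds.
move=> B nB.
have nV : nbhs (chart_map c s) ((fun y => B (chart_inv c y)) `&` U).
  by apply: filterI; [exact: chart_inv_near|exact: open_nbhs_nbhs].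
have [y [By Uy] uy] := positive_nearby oU Ux cu uE du nV.
by exists (chart_inv c y); split => //; apply/(sep y Uy).2.
Qed.

(** * Vanishing of the pressure *)

Theorem mainTheorem6 (R : realType) (S : topologicalType)
    (A : set (chart R S)) (kappa : R)
    (g : chart R S -> 'rV[R]_3 -> 'M[R]_3) (omega phi : S -> R)
    (p rho sigma : S -> R) (D : set S) (C0 : R)
    (kappa_gt0 : 0 < kappa)
    (* the static spacetime S x R *)
    (manifoldS : smooth_manifold A)
    (metric_g : riemannian_metric A g)
    (* the region occupied by the fluid and its boundary surface *)
    (openD : open D) (connectedD : connected D)
    (boundedD : compact (closure D))
    (boundary_neq0 : frontier D !=set0)
    (boundary_surface : surface_boundary A D)
    (* the field is non-singular, up to and including the boundary *)
    (omega_continuous : continuous omega)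
    (phi_continuous : continuous phi)
    (regular : regular_field A g omega phi (D `|` exterior D))
    (* charged perfect fluid inside, pure electric field outside *)
    (eqs_fluid : field_equations A kappa g omega phi p rho sigma D)
    (eqs_exterior : field_equations A kappa g omega phi
       (fun=> 0) (fun=> 0) (fun=> 0) (exterior D))
    (* junction conditions *)
    (junction_einstein : einstein_junction A g omega D)
    (junction_electric : electric_junction A phi D)
    (* the fluid is of Majumdar type *)
    (majumdar : forall s, D s -> expR (omega s) = (C0 + phi s) ^+ 2) :
  forall s, D s -> p s = 0.
Proof.
have [_ _ cover _] := manifoldS.
(* One boundary point is enough, since p e^(-omega) is a single constant on D. *)
have [s0 fs0] := boundary_neq0.
have [c Ac ds] := cover s0.
have [u sep] := boundary_surface s0 fs0 c Ac ds.
have oE : open (exterior D) by apply: closed_openC; exact: closed_closure.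
have regularD : regular_field A g omega phi D.
  move=> c' Ac'; have [h1 h2 h3] := regular c' Ac'.
  have sub : chart_map c' @` (chart_dom c' `&` D) `<=`
      chart_map c' @` (chart_dom c' `&` (D `|` exterior D)).
    by move=> x [s [d Ds] <-]; exists s => //; split => //; left.
  split; [move=> i j|..]; first exact: (Ck_sub sub (h1 i j)).
    exact: (Ck_sub sub h2).
  exact: (Ck_sub sub h3).
pose f s := p s / expR (omega s).
have lc s : D s -> \forall s' \near s, f s' = f s.
  move=> Ds; have [c' Ac' ds'] := cover s.
  exact: (majumdar_pressure_locally_constant kappa_gt0 metric_g openD regularD
    eqs_fluid Ac' majumdar ds' Ds).
move=> s Ds; pose lam := f s.
have pE r : D r -> p r = lam * expR (omega r).
  move=> Dr; rewrite /lam -(connected_locally_constant openD connectedD lc Dr Ds) /f.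
  by rewrite divfK // gt_eqF // expR_gt0.
have [l hl] := choice (fun i => junction_electric s0 fs0 c Ac ds i).
have [h hh] := junction_einstein s0 fs0 c Ac ds u sep.
pose eta := unit_normal (g c) u (chart_map c s0).
(* Uniqueness of limits requires both one-sided filters to be proper. *)
have FD : ProperFilter (within D (nbhs s0)) by exact: (within_nbhs_proper fs0.1).
have FE : ProperFilter (within (exterior D) (nbhs s0)).
  exact: (within_nbhs_proper (frontier_exterior openD ds fs0 sep)).
have subD : within D (nbhs s0) --> within (D `|` exterior D) (nbhs s0).
  by apply: within_subset => r; left.
have subE : within (exterior D) (nbhs s0) --> within (D `|` exterior D) (nbhs s0).
  by apply: within_subset => r; right.
have nD : within D (nbhs s0) --> s0 by exact: cvg_within.
have nE : within (exterior D) (nbhs s0) --> s0 by exact: cvg_within.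
(* The electromagnetic part of G(eta, eta), with [eta] frozen at its value at [s0]. *)
pose field r := (expR (omega r))^-1 *
  (2 * (eta *m (grad (phi \o chart_inv c) (chart_map c r))^T) 0 0 ^+ 2
   - field_strength2 (g c) (phi \o chart_inv c) (chart_map c r) *
     (eta *m g c (chart_map c r) *m eta^T) 0 0).
pose metric r : R := (eta *m g c (chart_map c r) *m eta^T) 0 0.
pose limit := (expR (omega s0))^-1 * (2 * (\sum_i eta 0 i * l i) ^+ 2
  - (\sum_k l k * \sum_d invmx (g c (chart_map c s0)) k d * l d) * metric s0).
have fieldD : field @ within D (nbhs s0) --> limit.
  have al i : (fun r => partial i (phi \o chart_inv c) (chart_map c r))
      @ within D (nbhs s0) --> l i by move=> P /(hl i); exact: subD.
  exact: (normal_field_cvg metric_g Ac ds omega_continuous _ nD al).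
have fieldE : field @ within (exterior D) (nbhs s0) --> limit.
  have al i : (fun r => partial i (phi \o chart_inv c) (chart_map c r))
      @ within (exterior D) (nbhs s0) --> l i by move=> P /(hl i); exact: subE.
  exact: (normal_field_cvg metric_g Ac ds omega_continuous _ nE al).
have metricD : metric @ within D (nbhs s0) --> metric s0.
  exact: (metric_form_cvg metric_g Ac ds _ nD).
pose stress r := normal_einstein (g c) (omega \o chart_inv c) eta (chart_map c r).
have stressD : stress @ within D (nbhs s0) --> h by move=> P /hh; exact: subD.
have stressE : stress @ within (exterior D) (nbhs s0) --> h by move=> P /hh; exact: subE.
have ndom : \forall r \near s0, chart_dom c r.
  by apply: open_nbhs_nbhs; split => //; exact: chart_dom_open.
(* Outside the pressure is zero, so G(eta, eta) coincides with its electromagnetic part there. *)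
have hE : h = limit.
  have e : \forall r \near within (exterior D) (nbhs s0), field r = stress r.
    rewrite near_withinE; apply: filterS ndom => r dr Er.
    rewrite /stress (normal_einstein_chart kappa_gt0 metric_g oE eqs_exterior Ac eta dr Er).
    by rewrite mulr0 mul0r oppr0 add0r.
  have stressE' : stress @ within (exterior D) (nbhs s0) --> limit.
    exact: (cvg_trans (near_eq_cvg e) fieldE).
  exact: (cvg_unique (@norm_hausdorff _ R^o) stressE stressE').
(* Inside, the difference of the two is the pressure term, where p is [lam] e^omega. *)
have e : \forall r \near within D (nbhs s0),
    field r - stress r = kappa * lam * (expR (omega r) * metric r).
  rewrite near_withinE; apply: filterS ndom => r dr Dr.
  rewrite /stress (normal_einstein_chart kappa_gt0 metric_g openD eqs_fluid Ac eta dr Dr).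
  by rewrite pE // -/(field r) -/(metric r); ring.
have lapseD : (fun r => expR (omega r)) @ within D (nbhs s0) --> expR (omega s0).
  have cl : {for s0, continuous (fun r => expR (omega r))}.
    exact: (continuous_comp (@omega_continuous s0) (@continuous_expR R _)).
  by move=> P /cl; exact: nD.
have c1 : (fun r => kappa * lam * (expR (omega r) * metric r)) @ within D (nbhs s0)
    --> kappa * lam * (expR (omega s0) * metric s0).
  exact: (cvgM (cvg_cst _) (cvgM lapseD metricD)).
have c2 : (fun r => kappa * lam * (expR (omega r) * metric r)) @ within D (nbhs s0)
    --> limit - h.
  exact: (cvg_trans (near_eq_cvg e) (cvgB fieldD stressD)).
have z : kappa * lam * (expR (omega s0) * metric s0) = limit - h.
  exact: (cvg_unique (@norm_hausdorff _ R^o) c1 c2).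
have m0 : metric s0 != 0.
  by rewrite gt_eqF // (unit_normal_form_gt0 metric_g Ac ds) //; case: sep.
(* kappa, e^omega at [s0] and g(eta, eta) are all nonzero, which leaves [lam] = p e^(-omega) at [s]
   as the vanishing factor. *)
move: z; rewrite hE subrr => /eqP.
rewrite !mulf_eq0 (negPf m0) expR_eq0 (gt_eqF kappa_gt0) !orbF /=.
by case/orP => [/eqP //|]; rewrite invr_eq0 expR_eq0.
Qed.
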